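(* Let $m\ge1$, let $f=\sum_{|\alpha|\ge1}a_\alpha X_\alpha$ be a positive regular free holomorphic function and let $\mathcal P$ be a family of noncommutative polynomials. If $A=(A_1,\dots,A_n)\in B(\mathcal H)^n$ is such that $\sum_{|\alpha|\ge1}a_\alpha A_\alpha A_\alpha^*$ is convergent in the weak operator topology and $p(A_1,\dots,A_n)=0$ for all $p\in\mathcal P$, then the following statements are equivalent. (i) There exist $T=(T_1,\dots,T_n)\in\mathcal V^m_{f,\mathcal P}(\mathcal H)$ with $(id-\Phi_{f,T})^m(I)>0$ and an invertible operator $Y\in B(\mathcal H)$ such that $$A_i=Y^{-1}T_iY,\qquad i=1,\dots,n.$$ (ii) $\Phi_{f,A}$ is power bounded and there exists a positive operator $Q\in B(\mathcal H)$ such that $(id-\Phi_{f,A})^m(Q)>0$. (iii) $r_f(A_1,\dots,A_n)<1$. (iv) $\lim_{k\to\infty}\|\Phi_{f,A}^k(I)\|=0$. (v) $\Phi_{f,A}$ is power bounded and there is an invertible positive operator $R\in B(\mathcal H)$ such that the equation $(id-\Phi_{f,A})^m(X)=R$ has a positive solution $X$ in $B(\mathcal H)$. Moreover, in this case, for any invertible positive operator $R\in B(\mathcal H)$, the equation $(id-\Phi_{f,A})^m(X)=R$ has a unique positive solution, namely, $$X:=\sum_{k=0}^\infty\binom{k+m-1}{m-1}\Phi_{f,A}^k(R),$$ where the convergence is in the uniform topology, and this solution is an invertible operator.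
   Context: Let $n\in\mathbb N=\{1,2,\dots\}$. $\mathbb F_n^+$ is the unital free semigroup on generators $g_1,\dots,g_n$ with identity $g_0$; $|\alpha|$ is the word length ($|g_0|=0$). For $X=(X_1,\dots,X_n)\in B(\mathcal H)^n$ ($\mathcal H$ a complex Hilbert space) put $X_\alpha=X_{i_1}\cdots X_{i_k}$ if $\alpha=g_{i_1}\cdots g_{i_k}$ and $X_{g_0}=I$. A positive regular free holomorphic function is a formal series $f=\sum_{\alpha\in\mathbb F_n^+}a_\alpha X_\alpha$ in noncommuting variables with $\limsup_{k\to\infty}(\sum_{|\alpha|=k}|a_\alpha|^2)^{1/2k}<\infty$, $a_\alpha\ge 0$ for all $\alpha$, $a_{g_0}=0$, and $a_{g_i}>0$ for $i=1,\dots,n$. Whenever $\sum_{|\alpha|\ge1}a_\alpha X_\alpha X_\alpha^*$ converges in the weak operator topology (WOT), $\Phi_{f,X}(Y)=\sum_{|\alpha|\ge1}a_\alpha X_\alpha YX_\alpha^*$ for $Y\in B(\mathcal H)$ (WOT convergence), and the joint spectral radius is $r_f(X_1,\dots,X_n)=\lim_{k\to\infty}\|\Phi_{f,X}^k(I)\|^{1/2k}$. $id$ is the identity map on $B(\mathcal H)$. A linear map $\varphi$ on $B(\mathcal H)$ is power bounded if there is $M>0$ with $\|\varphi^k\|\le M$ for all $k\in\mathbb N$. For self-adjoint $C,D$, $C<D$ means that $D-C$ is positive and invertible. $\mathbf D_f^m(\mathcal H)$ is the set of $X\in B(\mathcal H)^n$ (with the series above WOT convergent) such that $(id-\Phi_{f,X})^s(I)\ge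 0$ for $s=1,\dots,m$, and $\mathcal V^m_{f,\mathcal P}(\mathcal H)=\{X\in\mathbf D_f^m(\mathcal H): p(X_1,\dots,X_n)=0\ \forall p\in\mathcal P\}$. *)

(* Defs.v *)
From HB Require Import structures.
From mathcomp Require Import all_boot all_order all_algebra finmap.
From mathcomp Require Import sesquilinear complex.
From mathcomp Require Import all_classical all_reals all_analysis.

Set Implicit Arguments.
Unset Strict Implicit.
Unset Printing Implicit Defensive.

Import Order.TTheory GRing.Theory Num.Theory.
Import numFieldNormedType.Exports.

Local Open Scope classical_set_scope.
Local Open Scope complex_scope.
Local Open Scope ring_scope.

(* The library topology of a numFieldType K lives on K^o; this puts it on the
   concrete field R[i], where canonical inference does not find it. *)
HB.instance Definition _ (R : realType) := NormedModule.copy R[i] R[i]^o.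

HB.mixin Record isHilbert (R : realType) H & CompleteNormedModule R[i] H := {
  inner : {dot H for Num.conj};
  inner_norm : forall x : H, inner x x = `|x| ^+ 2
}.

#[short(type="hilbertType")]
HB.structure Definition Hilbert (R : realType) :=
  {H of isHilbert R H & CompleteNormedModule R[i] H}.

Section BoundedOperators.
Variables (R : realType) (H : hilbertType R).

Record bop := Bop {
  bop_fun :> H -> H;
  bop_linear : linear bop_fun;
  bop_continuous : continuous bop_fun
}.

Lemma bopP (S T : bop) : (S : H -> H) =1 T -> S = T.
Proof.
case: S T => [f lf cf] [g lg cg] /= /funext fg; subst g.
by rewrite (Prop_irrelevance lf lg) (Prop_irrelevance cf cg).
Qed.

HB.instance Definition _ := gen_eqMixin bop.
HB.instance Definition _ := gen_choiceMixin bop.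

Program Definition bop_zero := @Bop (fun=> 0) _ _.
Next Obligation. by move=> a x y; rewrite scaler0 addr0. Qed.
Next Obligation. by move=> x; exact: cvg_cst. Qed.

Program Definition bop_opp (S : bop) := @Bop (fun x => - S x) _ _.
Next Obligation. by move=> S a x y; rewrite bop_linear opprD scalerN. Qed.
Next Obligation. by move=> S x; apply: cvgN; exact: bop_continuous. Qed.

Program Definition bop_add (S T : bop) := @Bop (fun x => S x + T x) _ _.
Next Obligation.
by move=> S T a x y; rewrite !bop_linear scalerDr addrACA.
Qed.
Next Obligation. by move=> S T x; apply: cvgD; exact: bop_continuous. Qed.

Program Definition bop_scale (c : R[i]) (S : bop) :=
  @Bop (fun x => c *: S x) _ _.
Next Obligation.
by move=> c S a x y; rewrite bop_linear scalerDr !scalerA [c * a]mulrC.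
Qed.
Next Obligation.
by move=> c S x; apply: cvgZr; exact: bop_continuous.
Qed.

Program Definition bop_one := @Bop id _ _.
Next Obligation. by []. Qed.
Next Obligation. by move=> x; exact: cvg_id. Qed.

Program Definition bop_mul (S T : bop) := @Bop (fun x => S (T x)) _ _.
Next Obligation. by move=> S T a x y; rewrite !bop_linear. Qed.
Next Obligation.
by move=> S T x; apply: continuous_comp; exact: bop_continuous.
Qed.

Let addA : associative bop_add.
Proof. by move=> S T U; apply: bopP => x /=; rewrite addrA. Qed.
Let addC : commutative bop_add.
Proof. by move=> S T; apply: bopP => x /=; rewrite addrC. Qed.
Let add0 : left_id bop_zero bop_add.
Proof. by move=> S; apply: bopP => x /=; rewrite add0r. Qed.
Let addN : left_inverse bop_zero bop_opp bop_add.
Proof. by move=> S; apply: bopP => x /=; rewrite addNr. Qed.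

HB.instance Definition _ := GRing.isZmodule.Build bop addA addC add0 addN.

Lemma bop0E x : (0 : bop) x = 0. Proof. by []. Qed.
Lemma bopDE (S T : bop) x : (S + T) x = S x + T x. Proof. by []. Qed.
Lemma bopNE (S : bop) x : (- S) x = - S x. Proof. by []. Qed.

Let mulA : associative bop_mul. Proof. by move=> S T U; exact: bopP. Qed.
Let mul1l : left_id bop_one bop_mul. Proof. by move=> S; exact: bopP. Qed.
Let mul1r' : right_id bop_one bop_mul. Proof. by move=> S; exact: bopP. Qed.
Let mulDl : left_distributive bop_mul +%R.
Proof. by move=> S T U; exact: bopP. Qed.
Let mulDr : right_distributive bop_mul +%R.
Proof.
move=> S T U; apply: bopP => x /=.
by have := bop_linear S 1 (T x) (U x); rewrite !scale1r.
Qed.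

HB.instance Definition _ :=
  GRing.Zmodule_isPzRing.Build bop mulA mul1l mul1r' mulDl mulDr.

Lemma bop1E x : (1 : bop) x = x. Proof. by []. Qed.
Lemma bopME (S T : bop) x : (S * T) x = S (T x). Proof. by []. Qed.

Let scaleA a b (S : bop) :
  bop_scale a (bop_scale b S) = bop_scale (a * b) S.
Proof. by apply: bopP => x /=; rewrite scalerA. Qed.
Let scale1 : left_id 1 bop_scale.
Proof. by move=> S; apply: bopP => x /=; rewrite scale1r. Qed.
Let scaleDr : right_distributive bop_scale +%R.
Proof. by move=> a S T; apply: bopP => x /=; rewrite scalerDr. Qed.
Let scaleDl (S : bop) : {morph bop_scale^~ S : a b / a + b}.
Proof. by move=> a b; apply: bopP => x /=; rewrite scalerDl. Qed.

HB.instance Definition _ :=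
  GRing.Zmodule_isLmodule.Build R[i] bop scaleA scale1 scaleDr scaleDl.

Lemma bopZE a (S : bop) x : (a *: S) x = a *: S x. Proof. by []. Qed.

End BoundedOperators.

Notation "''B' ( H )" := (bop H) (at level 8, format "''B' ( H )").

Section OperatorNotions.
Variables (R : realType) (H : hilbertType R).
Implicit Types (S T : 'B(H)) (phi : 'B(H) -> 'B(H)).

(* Norms on H take values in R[i]; they are real, so Re loses nothing. *)
Definition opnorm T : R :=
  sup [set complex.Re `|T x| | x in [set x : H | `|x| <= 1]].

(* The adjoint exists and is unique by Riesz' theorem, so the default value of
   xget is never used. *)
Definition adj T : 'B(H) :=
  xget 0 [set S : 'B(H) | forall x y, inner (T x) y = inner x (S y)].

(* The order of R[i] makes 0 <= z say that z is real and nonnegative. *)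
Definition positive T := forall x, 0 <= inner (T x) x.

Definition inverse_of S T := S * T = 1 /\ T * S = 1.

Definition invertible T := exists S, inverse_of S T.

Definition op_le S T := positive (T - S).

Definition op_lt S T := positive (T - S) /\ invertible (T - S).

Definition wot_cvg (u : nat -> 'B(H)) T :=
  forall x y, (fun N => inner (u N x) y) @ \oo --> inner (T x) y.

Definition uniform_cvg (u : nat -> 'B(H)) T :=
  (fun N => opnorm (u N - T)) @ \oo --> (0 : R).

(* Extended real, since an arbitrary phi may be unbounded. *)
Definition mapnorm phi : \bar R :=
  ereal_sup [set (opnorm (phi Y))%:E | Y in [set Y | opnorm Y <= 1]].

Definition power_bounded phi :=
  exists2 M : R, 0 < M &
    forall k, (1 <= k)%N -> (mapnorm (iter k phi) <= M%:E)%E.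

(* (id - phi)^s *)
Definition defect phi s : 'B(H) -> 'B(H) := iter s (fun Y => Y - phi Y).

End OperatorNotions.

(* A formal series sum_w a_w X_w in n noncommuting variables is its family of
   coefficients, indexed by the words of the free semigroup: seq 'I_n with
   concatenation, [::] being the identity and size the length. *)
Record positive_regular (R : realType) (n : nat) (a : seq 'I_n -> R) : Prop := {
  coef_limsup : (limn_esup (fun k =>
    ((\sum_(w : k.-tuple 'I_n) `|a w| ^+ 2) `^ (2 * k)%N%:R^-1)%:E) < +oo)%E;
  coef_ge0 : forall w, 0 <= a w;
  coef_nil : a [::] = 0;
  coef_gen : forall i, 0 < a [:: i]
}.

(* Finitely supported coefficient families. *)
Notation ncpoly R n := {fsfun seq 'I_n -> R[i] with 0}.

Section NoncommutativeDomains.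
Variables (R : realType) (H : hilbertType R) (n : nat).
Implicit Types (a : seq 'I_n -> R) (X : 'I_n -> 'B(H)) (Y : 'B(H)).

Definition op_word X (w : seq 'I_n) : 'B(H) := \prod_(i <- w) X i.

Definition nc_eval X (p : ncpoly R n) : 'B(H) :=
  \sum_(w <- finsupp p) p w *: op_word X w.

(* Sums over words of length >= 1 are taken as limits of the sums over
   1 <= |w| <= N. *)
Definition Phi_psum a X Y (N : nat) : 'B(H) :=
  \sum_(1 <= k < N.+1) \sum_(w : k.-tuple 'I_n)
    (a w)%:C *: (op_word X w * Y * adj (op_word X w)).

Definition Phi_summable a X := exists T, wot_cvg (Phi_psum a X 1) T.

(* When Phi_summable a X holds and a >= 0, the WOT limit exists for every Y, and
   it is unique. *)
Definition Phi a X Y : 'B(H) := xget 0 [set T | wot_cvg (Phi_psum a X Y) T].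

(* The limit exists when Phi_summable a X holds and a >= 0, because
   k |-> opnorm (Phi^k 1) is then submultiplicative. *)
Definition joint_radius a X : R :=
  limn (fun k => opnorm (iter k (Phi a X) 1) `^ (2 * k)%N%:R^-1).

Definition nc_domain a (m : nat) : set ('I_n -> 'B(H)) :=
  [set X | Phi_summable a X /\
    forall s, (1 <= s <= m)%N -> op_le 0 (defect (Phi a X) s 1)].

Definition nc_variety a (m : nat) (P : set (ncpoly R n)) :
    set ('I_n -> 'B(H)) :=
  [set X | nc_domain a m X /\ forall p, P p -> nc_eval X p = 0].

End NoncommutativeDomains.

(* Main.v *)
Require Import Defs.
From HB Require Import structures.
From mathcomp Require Import all_boot all_order all_algebra finmap.
From mathcomp Require Import sesquilinear complex lra ring.
From mathcomp Require Import all_classical all_reals all_analysis.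

(** The map [phi := Phi a A] is linear and positive on B(H), and all of the
    equivalences except those with (i) hold for any positive linear map [phi].
    Everything is governed by one property, geometric decay:
    [opnorm (phi^k 1) <= C * q ^ k] with [q < 1] ([decaying]).

    Since [phi] is positive, [opnorm (phi T) <= opnorm T * opnorm (phi 1)] for
    positive [T], hence [opnorm (phi T) <= 6 * opnorm T * opnorm (phi 1)] for
    every [T] ([pmap_opnorm]): the powers of [phi] are controlled by their values
    at 1, and [k |-> opnorm (phi^k 1)] is submultiplicative. By Fekete's argument
    its roots of order 2k converge to their infimum, so (iii), (iv) and geometric
    decay are equivalent ([decaying_root], [decaying_cvg0]).

    (ii) gives decay: if [phi] is power bounded, [Q >= 0] and
    [(id - phi)^m Q >= c > 0], then every lower defect [(id - phi)^s Q] is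
    positive ([defect_positive]): if [E := D - phi D] satisfies [phi E <= E] and
    takes a negative value, then the sums of the [phi^k E] are unbounded, although
    they telescope to [D - phi^N D]. For [D := (id - phi)^(m-1) Q]
    this leaves [D >= 0] and [D - phi D >= c]. With [d > 0] an upper bound of [D],
    [phi D <= D - c <= (1 - c / d) D], and comparing [D] with multiples of 1 on
    both sides gives geometric decay of [phi^k 1] ([decaying_of_defect]).

    Decay makes the binomial series converge in norm. Pascal's rule says that
    [id - phi] lowers the binomial index of its partial sums by one, so its sum
    solves [(id - phi)^m X = S]; as [phi^k -> 0], [id - phi] is injective and the
    solution is unique; the term of index 0 gives [X >= S], so [X] is invertible
    when [S] is. This yields (v) and the last part of the statement.

    Finally (i) is transported by similarity: if [X' i = V * X i * W] with [V], [W]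
    mutually inverse, then [Phi a X' (V * Z * adj V) = V * Phi a X Z * adj V]
    ([Phi_similar]). From (i), [V * adj V] is the operator [Q] of (ii). From (v), the
    lower defects of the solution [X] are positive, so [X >= S > 0] has an
    invertible self-adjoint square root [Z], and [T i = Z^-1 A i Z] works.

    The operator theory that this uses is built first: adjoints from Riesz'
    theorem, the order on self-adjoint operators, strong limits of bounded
    monotone sequences (which make [Phi a X Y] exist), inverses and square roots
    as norm limits of contractive iterations. All estimates are made with the
    real part of the inner product. *)

Set Implicit Arguments.
Unset Strict Implicit.
Unset Printing Implicit Defensive.

Import Order.TTheory GRing.Theory Num.Theory.
Import numFieldNormedType.Exports.

Local Open Scope classical_set_scope.
Local Open Scope complex_scope.
Local Open Scope ring_scope.

(** * The underlying real Hilbert space *)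
Section HilbertReal.
Context {R : realType} {H : hilbertType R}.
Implicit Types (x y z : H) (r : R) (u : nat -> H).

(** Norms on [H] are nonnegative elements of [R[i]]; working with their real
    values gives access to the theory of ordered real fields. *)
Definition nrm x : R := complex.Re `|x|.

(** [H] seen as a real inner product space. The complex inner product is
    recovered from it by [innerE], and complex linearity by compatibility with
    multiplication by [i]. *)
Definition rdot x y : R := complex.Re (inner x y).

Lemma normE x : `|x| = (nrm x)%:C.
Proof.
by rewrite /nrm; have := normr_ge0 x; case: `|x| => a b; rewrite lecE /= => /andP[/eqP -> _].
Qed.

Lemma normcR r : `|r%:C| = `|r|%:C.
Proof. by rewrite normc_def /= expr0n /= addr0 sqrtr_sqr. Qed.

Lemma nrm_ge0 x : 0 <= nrm x.
Proof. by rewrite -ler0c -normE. Qed.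

Lemma nrm_eq0 x : nrm x = 0 -> x = 0.
Proof. by move=> x0; apply/normr0_eq0; rewrite normE x0. Qed.

Lemma nrm0 : nrm (0 : H) = 0.
Proof. by rewrite /nrm normr0. Qed.

Lemma nrmD x y : nrm (x + y) <= nrm x + nrm y.
Proof.
by have := ler_normD x y; rewrite !normE -rmorphD /= lecR.
Qed.

Lemma nrmN x : nrm (- x) = nrm x.
Proof. by rewrite /nrm normrN. Qed.

Lemma nrmB x y : nrm (x - y) = nrm (y - x).
Proof. by rewrite /nrm distrC. Qed.

Lemma nrmZ r x : nrm (r%:C *: x) = `|r| * nrm x.
Proof. by apply: complexI; rewrite rmorphM /= -!normE normrZ normcR. Qed.

Lemma nrmZC (a : R[i]) x : nrm (a *: x) = complex.Re `|a| * nrm x.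
Proof.
by apply: complexI; rewrite rmorphM /= -!normE normrZ; congr (_ * _).
Qed.

Lemma normCi : `|'i%C : R[i]| = 1.
Proof. by rewrite normc_def /= expr0n /= add0r expr1n sqrtr1. Qed.

Lemma nrmi x : nrm ('i%C *: x) = nrm x.
Proof. by rewrite /nrm normrZ normCi mul1r. Qed.


Lemma innerC x y : inner y x = conjc (inner x y).
Proof. by rewrite hermC expr0 mul1r. Qed.

Lemma ReD (z w : R[i]) : complex.Re (z + w) = complex.Re z + complex.Re w.
Proof. by case: z w => [a b] [c d]. Qed.

Lemma ReN (z : R[i]) : complex.Re (- z) = - complex.Re z.
Proof. by case: z. Qed.

Lemma innerZl (c : R[i]) x y : inner (c *: x) y = c * inner x y.
Proof. exact: linearZl_LR. Qed.

Lemma innerZr (c : R[i]) x y : inner x (c *: y) = conjc c * inner x y.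
Proof. by rewrite innerC innerZl rmorphM /= -innerC. Qed.

Lemma rdotC x y : rdot x y = rdot y x.
Proof. by rewrite /rdot innerC; case: (inner y x). Qed.

Lemma rdotDl x y z : rdot (x + y) z = rdot x z + rdot y z.
Proof. by rewrite /rdot linearDl ReD. Qed.

Lemma rdotNl x y : rdot (- x) y = - rdot x y.
Proof. by rewrite /rdot linearNl ReN. Qed.

Lemma rdotZl r x y : rdot (r%:C *: x) y = r * rdot x y.
Proof.
by rewrite /rdot innerZl [in RHS](complexE (inner x y)); case: (inner x y) => a b /=; ring.
Qed.

Lemma rdotDr x y z : rdot x (y + z) = rdot x y + rdot x z.
Proof. by rewrite rdotC rdotDl !(rdotC x). Qed.

Lemma rdotNr x y : rdot x (- y) = - rdot x y.
Proof. by rewrite rdotC rdotNl rdotC. Qed.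

Lemma rdotZr r x y : rdot x (r%:C *: y) = r * rdot x y.
Proof. by rewrite rdotC rdotZl rdotC. Qed.

Lemma rdotBl x y z : rdot (x - y) z = rdot x z - rdot y z.
Proof. by rewrite rdotDl rdotNl. Qed.

Lemma rdotBr x y z : rdot x (y - z) = rdot x y - rdot x z.
Proof. by rewrite rdotDr rdotNr. Qed.

Lemma rdot0l x : rdot 0 x = 0.
Proof. by rewrite /rdot linear0l. Qed.

Lemma rdot0r x : rdot x 0 = 0.
Proof. by rewrite rdotC rdot0l. Qed.

Lemma rdoti x y : rdot ('i%C *: x) ('i%C *: y) = rdot x y.
Proof.
rewrite /rdot innerZl innerZr.
by case: (inner x y) => a b; rewrite /GRing.mul /=; ring.
Qed.

Lemma rdotil x y : rdot ('i%C *: x) y = - rdot x ('i%C *: y).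
Proof.
by rewrite -(rdoti x) scalerA -expr2 sqr_i scaleN1r rdotNr opprK.
Qed.

Lemma innerE x y : inner x y = rdot x y +i* rdot x ('i%C *: y).
Proof.
rewrite /rdot innerZr; case: (inner x y) => a b.
by congr (_ +i* _); rewrite /GRing.mul /=; ring.
Qed.

Lemma rdotxx x : rdot x x = nrm x ^+ 2.
Proof. by rewrite /rdot inner_norm normE -rmorphXn. Qed.

Lemma nrm2Dt x y r :
  nrm (x + r%:C *: y) ^+ 2 = nrm x ^+ 2 + 2 * r * rdot x y + r ^+ 2 * nrm y ^+ 2.
Proof.
rewrite -!rdotxx rdotDl !rdotDr !rdotZl !rdotZr (rdotC y x); ring.
Qed.

(** The discriminant argument, at the minimum [- <x,y> / |y|^2] of the
    quadratic [r |-> |x + r y|^2]. *)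
Lemma CauchySchwarzR x y : `|rdot x y| <= nrm x * nrm y.
Proof.
have [y0|y_neq0] := eqVneq (nrm y) 0.
  by rewrite (nrm_eq0 y0) rdot0r normr0 nrm0 mulr0.
rewrite -(@ler_pXn2r _ 2) ?nnegrE ?mulr_ge0 ?nrm_ge0 //.
rewrite real_normK ?num_real // exprMn.
have := sqr_ge0 (nrm (x + (- rdot x y / nrm y ^+ 2)%:C *: y)).
rewrite nrm2Dt.
have -> : nrm x ^+ 2 + 2 * (- rdot x y / nrm y ^+ 2) * rdot x y +
    (- rdot x y / nrm y ^+ 2) ^+ 2 * nrm y ^+ 2 =
    nrm x ^+ 2 - rdot x y ^+ 2 / nrm y ^+ 2 by field.
rewrite subr_ge0 ler_pdivrMr // exprn_gt0 // lt_def y_neq0; exact: nrm_ge0.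
Qed.

Lemma rdot_le x y : rdot x y <= nrm x * nrm y.
Proof. exact: le_trans (ler_norm _) (CauchySchwarzR x y). Qed.

Lemma parallelogram x y :
  nrm (x - y) ^+ 2 + nrm (x + y) ^+ 2 = 2 * nrm x ^+ 2 + 2 * nrm y ^+ 2.
Proof.
rewrite -!rdotxx rdotBl rdotDl !rdotBr !rdotDr (rdotC y x); ring.
Qed.

Lemma rdot_eq x y : (forall z, rdot x z = rdot y z) -> x = y.
Proof.
move=> h; apply/subr0_eq/nrm_eq0/eqP.
by have /eqP := rdotxx (x - y); rewrite rdotBl h subrr eq_sym sqrf_eq0.
Qed.

Lemma cvgHP u x : u @ \oo --> x <-> (fun N => nrm (u N - x)) @ \oo --> (0 : R).
Proof.
split=> [/cvgrPdist_lt h|/cvgrPdist_lt h]; apply/cvgrPdist_lt.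
  move=> e e0; have /h : 0 < e%:C by rewrite ltcR.
  apply: filterS => N; rewrite normE ltcR sub0r normrN nrmB.
  by rewrite ger0_norm // nrm_ge0.
move=> e; rewrite ltcE /= => /andP[/eqP e0 /h].
apply: filterS => N; rewrite sub0r normrN ger0_norm ?nrm_ge0 // nrmB => le.
by rewrite normE ltcE /= -e0 eqxx.
Qed.

Lemma cauchyH u :
  (forall e : R, 0 < e -> exists N, forall i j, (N <= i)%N -> (N <= j)%N ->
     nrm (u i - u j) < e) ->
  exists x, (fun N => nrm (u N - x)) @ \oo --> (0 : R).
Proof.
move=> h; suff /cvg_ex[x /cvgHP ?] : cvg (u @ \oo) by exists x.
apply/cauchy_cvgP/cauchy_ballP => e; rewrite ltcE /= => /andP[/eqP e0 /h[N hN]].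
exists (u @` [set k | (N <= k)%N], u @` [set k | (N <= k)%N]) => /=.
  by split; exists N => // k /= Nk; exists k.
move=> [_ _] /= [[i Ni <-] [j Nj <-]].
by rewrite -ball_normE /= normE ltcE /= -e0 eqxx hN.
Qed.

End HilbertReal.

(** * Real sequences *)
Section RealSequences.
Context {R : realType}.
Implicit Types (f g : nat -> R) (l : R).

Lemma cvg_ge0 f l : (forall N, 0 <= f N) -> f @ \oo --> l -> 0 <= l.
Proof.
move=> f0 fl; rewrite -(cvg_lim _ fl)//; apply: limr_ge; first exact: (cvgP _ fl).
exact: nearW.
Qed.

Lemma cvg_le f g l k :
  (forall N, f N <= g N) -> f @ \oo --> l -> g @ \oo --> k -> l <= k.
Proof.
move=> fg fl gk; rewrite -subr_ge0; apply: cvg_ge0 (cvgB gk fl).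
by move=> N /=; rewrite subr_ge0.
Qed.

Lemma squeeze0 f g :
  (forall N, 0 <= f N <= g N) -> g @ \oo --> (0 : R) -> f @ \oo --> (0 : R).
Proof. by move=> fg; apply: squeeze_cvgr (@cvg_cst _ _ _ _ _); exact: nearW. Qed.

Lemma cvg_squeeze f g l :
  (forall N, `|f N - l| <= g N) -> g @ \oo --> (0 : R) -> f @ \oo --> l.
Proof.
move=> fg g0; have /cvgrPdist_lt h : (fun N => `|f N - l|) @ \oo --> (0 : R).
  by apply: squeeze0 g0 => N; rewrite normr_ge0 fg.
apply/cvgrPdist_lt => e /h; apply: filterS => N.
by rewrite sub0r normrN normr_id distrC.
Qed.

Lemma cvg0Ml f c : f @ \oo --> (0 : R) -> (fun N => c * f N) @ \oo --> (0 : R).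
Proof. by move=> f0; rewrite -[X in _ --> X](mulr0 c); exact: cvgMr. Qed.

Lemma cvg0Mr f c : f @ \oo --> (0 : R) -> (fun N => f N * c) @ \oo --> (0 : R).
Proof. by move=> f0; rewrite -[X in _ --> X](mul0r c); exact: cvgMl. Qed.

Lemma cvg0D f g : f @ \oo --> (0 : R) -> g @ \oo --> (0 : R) ->
  (fun N => f N + g N) @ \oo --> (0 : R).
Proof. by move=> f0 g0; rewrite -[X in _ --> X](addr0 0); exact: cvgD. Qed.

End RealSequences.

(** * Riesz representation *)
Section Riesz.
Context {R : realType} {H : hilbertType R}.
Variables (l : H -> R) (M : R).
Hypothesis lD : forall x y, l (x + y) = l x + l y.
Hypothesis lZ : forall (r : R) x, l (r%:C *: x) = r * l x.
Hypothesis l_le : forall x, `|l x| <= M * nrm x.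

(** If [l x = <x,u>], then [J x = |x - u|^2 - |u|^2], so the representing vector
    [u] can be found by minimizing [J]. *)
Let J x := nrm x ^+ 2 - 2 * l x.

Let J_ge x : - M ^+ 2 <= J x.
Proof.
rewrite /J; have := l_le x; rewrite ler_norml => /andP[_ h].
have := sqr_ge0 (nrm x - M); nra.
Qed.

Let I := inf (range J).

Let J_has_inf : has_inf (range J).
Proof. by split; [exists (J 0), 0 | exists (- M ^+ 2) => _ [x _ <-]]. Qed.

Let I_le x : I <= J x.
Proof. by apply: ge_inf; [case: J_has_inf | exists x]. Qed.

Let J_near_inf N : exists x, J x < I + N.+1%:R^-1.
Proof.
have [|_ [x _ <-] xI] := @inf_adherent _ (range J) N.+1%:R^-1 _ J_has_inf.
  by rewrite invr_gt0.
by exists x.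
Qed.

(** The parallelogram law makes minimizing sequences of [J] Cauchy. *)
Let J_mid x y : nrm (x - y) ^+ 2 <= 2 * (J x - I) + 2 * (J y - I).
Proof.
have := I_le ((2^-1)%:C *: (x + y)).
rewrite /J nrmZ lZ lD ger0_norm ?invr_ge0// exprMn.
have := parallelogram x y.
set a := nrm (x - y) ^+ 2; set b := nrm (x + y) ^+ 2.
by rewrite exprVn; lra.
Qed.

Lemma riesz : exists u, forall x, l x = rdot x u.
Proof.
have /choice[v vJ] := J_near_inf.
have [|u vu] := @cauchyH _ _ v.
  move=> e e0.
  have e2 : 0 < e ^+ 2 / 4 by rewrite divr_gt0 ?exprn_gt0.
  have [N _ hN] := near_infty_natSinv_lt (PosNum e2).
  have {}hN k : (N <= k)%N -> k.+1%:R^-1 < e ^+ 2 / 4 by exact: hN.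
  exists N => i j Ni Nj; rewrite -(@ltr_pXn2r _ 2) ?nnegrE ?nrm_ge0 ?ltW//.
  have := J_mid (v i) (v j); have := vJ i; have := vJ j.
  have := hN _ Ni; have := hN _ Nj.
  move: (J (v i)) (J (v j)) (nrm _ ^+ 2) (e ^+ 2) I => p q k E I'.
  by move: i.+1%:R^-1 j.+1%:R^-1 => b c; lra.
exists u => x.
have vx : (fun N => rdot x (v N)) @ \oo --> rdot x u.
  apply: (@cvg_squeeze _ _ (fun N => nrm x * nrm (v N - u))).
    by move=> N; rewrite -rdotBr; exact: CauchySchwarzR.
  by rewrite -[X in _ --> X](mulr0 (nrm x)); apply: cvgMr; exact: vu.
(* First variation of [J] at the limit [u]: compare the values of [J] at
   [v N] and [v N + t x] and let [N] go to infinity. *)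
have key (t : R) : 0 <= t ^+ 2 * nrm x ^+ 2 + 2 * t * (rdot x u - l x).
  have h0 : (fun N => t ^+ 2 * nrm x ^+ 2 + 2 * t * (rdot x (v N) - l x)
     + N.+1%:R^-1) @ \oo --> t ^+ 2 * nrm x ^+ 2 + 2 * t * (rdot x u - l x) + 0.
    apply: cvgD; last exact: cvg_harmonic.
    apply: cvgD; first exact: cvg_cst.
    by apply: cvgMr; apply: cvgB => //; exact: cvg_cst.
  rewrite addr0 in h0; apply: cvg_ge0 h0 => N.
  have := I_le (v N + t%:C *: x); have := vJ N.
  by rewrite /J nrm2Dt lD lZ (rdotC x); move: N.+1%:R^-1 => c; lra.
apply/eqP; rewrite eq_sym -subr_eq0.
(* This [t] is defined even when [x = 0], unlike the minimizer in [t]. *)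
have := key (- (rdot x u - l x) / (nrm x ^+ 2 + 1)).
set d := _ - l x; set q := nrm x ^+ 2.
have q0 : 0 <= q by exact: sqr_ge0.
have -> : (- d / (q + 1)) ^+ 2 * q + 2 * (- d / (q + 1)) * d =
   - (d ^+ 2 * (q + 2) / (q + 1) ^+ 2) by field; lra.
have c_gt0 : 0 < (q + 2) / (q + 1) ^+ 2.
  by rewrite divr_gt0 ?exprn_gt0; lra.
by rewrite oppr_ge0 -mulrA pmulr_lle0 // => h; rewrite -sqrf_eq0 eq_le h sqr_ge0.
Qed.

End Riesz.

(** * Bounded operators and the operator norm *)
Section Operators.
Context {R : realType} {H : hilbertType R}.
Implicit Types (S T : 'B(H)) (x y z : H) (r c : R).

HB.instance Definition _ T :=
  GRing.isLinear.Build R[i] H H *:%R T (bop_linear T).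

Lemma opBE S T x : (S - T) x = S x - T x. Proof. by []. Qed.

(** A linear map that is below 1 on a ball of radius [d] around 0 is bounded by
    [2 / d]: rescale every vector to norm [d / 2]. *)
Lemma op_bounded T : exists2 M, 0 <= M & forall x, nrm (T x) <= M * nrm x.
Proof.
have /cvgr_dist_lt/(_ 1 ltr01) := @bop_continuous _ _ T 0.
move=> /nbhs_ballP[e /=]; rewrite ltcE /= => /andP[/eqP e0 e_gt0] he.
set d := complex.Re e in e_gt0 e0 he.
exists (2 / d); first by rewrite divr_ge0 // ltW.
move=> x; have [x0|x_neq0] := eqVneq (nrm x) 0.
  by rewrite (nrm_eq0 x0) linear0 !nrm0 mulr0.
have x_gt0 : 0 < nrm x by rewrite lt_def x_neq0 nrm_ge0.
have := he ((d / 2 / nrm x)%:C *: x).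
rewrite -ball_normE /= linear0 !sub0r !normrN !normE linearZ !nrmZ.
rewrite !ltcE /= -e0 eqxx /= ger0_norm; last by rewrite !divr_ge0 ?ltW.
have -> : d / 2 / nrm x * nrm x = d / 2 by field.
have -> : d / 2 / nrm x * nrm (T x) = nrm (T x) / (2 / d * nrm x).
  by field; rewrite x_neq0 gt_eqF.
have xd : 0 < 2 / d * nrm x by rewrite mulr_gt0 ?divr_gt0.
rewrite [_ / _ < 1]ltr_pdivrMr // mul1r => h; apply/ltW/h.
by rewrite -/d; lra.
Qed.

Lemma nrm_op T x : nrm (T x) <= opnorm T * nrm x.
Proof.
have [x0|x_neq0] := eqVneq (nrm x) 0.
  by rewrite (nrm_eq0 x0) linear0 !nrm0 mulr0.
have x_gt0 : 0 < nrm x by rewrite lt_def x_neq0 nrm_ge0.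
have [M M0 hM] := op_bounded T.
rewrite -ler_pdivrMr //; apply: ub_le_sup.
  exists M => _ [y /= y1 <-]; apply: le_trans (hM y) _.
  by move: y1; rewrite normE -[1]/(1%:C) lecR => y1; rewrite ler_piMr.
exists ((nrm x)^-1%:C *: x).
  rewrite /= normE nrmZ ger0_norm ?invr_ge0 ?nrm_ge0 // mulVf //.
rewrite linearZ -/(nrm _) nrmZ ger0_norm ?invr_ge0 ?nrm_ge0 //.
by rewrite mulrC.
Qed.

Lemma opnorm_le T c : 0 <= c -> (forall x, nrm (T x) <= c * nrm x) ->
  opnorm T <= c.
Proof.
move=> c0 h; apply: sup_le_ub.
  by exists (complex.Re `|T 0|), 0 => //=; rewrite normr0.
move=> _ [x /= + <-]; rewrite normE -[1]/(1%:C) lecR => x1.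
by apply: le_trans (h x) _; rewrite ler_piMr.
Qed.

Lemma opnorm_ge0 T : 0 <= opnorm T.
Proof.
have [M M0 hM] := op_bounded T; apply: ub_le_sup.
  exists M => _ [y /= y1 <-]; apply: le_trans (hM y) _.
  by move: y1; rewrite normE -[1]/(1%:C) lecR => y1; rewrite ler_piMr.
by exists 0; rewrite /= ?normr0 ?ler01 // linear0 normr0.
Qed.

Lemma opnorm_bound T c x : opnorm T <= c -> nrm (T x) <= c * nrm x.
Proof.
by move=> h; apply: le_trans (nrm_op T x) _; rewrite ler_wpM2r ?nrm_ge0.
Qed.

Lemma opnormM S T : opnorm (S * T) <= opnorm S * opnorm T.
Proof.
apply: opnorm_le => [|x]; first by rewrite mulr_ge0 ?opnorm_ge0.
rewrite bopME; apply: le_trans (nrm_op _ _) _; rewrite -mulrA.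
by rewrite ler_wpM2l ?opnorm_ge0 ?nrm_op.
Qed.

Lemma opnormD S T : opnorm (S + T) <= opnorm S + opnorm T.
Proof.
apply: opnorm_le => [|x]; first by rewrite addr_ge0 ?opnorm_ge0.
by rewrite mulrDl; apply: le_trans (nrmD _ _) _; rewrite lerD ?nrm_op.
Qed.

Lemma opnormZ r T : opnorm (r%:C *: T) <= `|r| * opnorm T.
Proof.
apply: opnorm_le => [|x]; first by rewrite mulr_ge0 ?opnorm_ge0.
by rewrite bopZE nrmZ -mulrA ler_wpM2l ?nrm_op.
Qed.

Lemma opnormi T : opnorm ('i%C *: T) <= opnorm T.
Proof.
by apply: opnorm_le (opnorm_ge0 _) _ => x; rewrite bopZE nrmi nrm_op.
Qed.

Lemma opnormN T : opnorm (- T) = opnorm T.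
Proof. by congr sup; apply: eq_imagel => x _; rewrite /= normrN. Qed.

Lemma opnorm0 : opnorm (0 : 'B(H)) = 0.
Proof.
apply/eqP; rewrite eq_le opnorm_ge0 andbT.
by apply: opnorm_le => // x; rewrite bop0E nrm0 mul0r.
Qed.

Lemma opnorm_eq0 T : opnorm T = 0 -> T = 0.
Proof.
move=> T0; apply: bopP => x; apply: nrm_eq0; apply/eqP.
by rewrite eq_le nrm_ge0 andbT -(mul0r (nrm x)) -T0 nrm_op.
Qed.

Lemma opnorm1 : opnorm (1 : 'B(H)) <= 1.
Proof. by apply: opnorm_le => // x; rewrite mul1r. Qed.

Lemma bop_of_bounded (f : H -> H) M : linear f ->
  (forall x, nrm (f x) <= M * nrm x) -> exists T, T =1 f :> (H -> H).
Proof.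
move=> fl fM; suff fc : continuous f by exists (Bop fl fc).
have fB x y : f x - f y = f (x - y).
  by have := fl (-1) y x; rewrite !scaleN1r ![- _ + _]addrC.
move=> x; apply/cvgrPdist_lt => e; rewrite ltcE /= => /andP[/eqP e0 e_gt0].
have M0 : 0 < `|M| + 1 by rewrite ltr_wpDl.
apply/nbhs_ballP; exists (complex.Re e / (`|M| + 1))%:C.
  by rewrite /= ltcR divr_gt0.
move=> y; rewrite -ball_normE /= !normE fB ltcR ltr_pdivlMr // => h.
rewrite ltcE /= -e0 eqxx /=; apply: le_lt_trans h.
apply: le_trans (fM _) _; rewrite mulrC ler_wpM2l ?nrm_ge0 //.
by rewrite (le_trans (ler_norm M)) // lerDl.
Qed.

End Operators.

(** * Adjoints *)
Section Adjoint.
Context {R : realType} {H : hilbertType R}.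
Implicit Types (S T U : 'B(H)) (x y z : H) (r c : R).

Lemma inner_rdot S T :
  (forall x y, rdot (T x) y = rdot x (S y)) ->
  forall x y, inner (T x) y = inner x (S y).
Proof. by move=> h x y; rewrite !innerE -linearZ !h. Qed.

(** Riesz' theorem for [x |-> rdot (T x) y] gives a vector depending on [y];
    uniqueness of that vector makes it a complex linear function of [y]. *)
Lemma adj_exists T : exists S, forall x y, inner (T x) y = inner x (S y).
Proof.
have [M M0 hM] := op_bounded T.
have riesz_y y : exists u, forall x, rdot (T x) y = rdot x u.
  apply: (@riesz _ _ (fun x => rdot (T x) y) (M * nrm y)) => [x z|r x|x].
  - by rewrite linearD rdotDl.
  - by rewrite linearZ rdotZl.
  - apply: le_trans (CauchySchwarzR _ _) _; rewrite mulrAC.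
    by rewrite ler_wpM2r ?nrm_ge0.
have [f fP] := choice riesz_y.
have flin : linear f.
  move=> a x y; apply: rdot_eq => z; rewrite !(rdotC _ z) -fP.
  rewrite !rdotDr -fP; congr (_ + _).
  rewrite [a]complexE !scalerDl !rdotDr !rdotZr -fP; congr (_ + _).
  rewrite [_ * _%:C]mulrC -!scalerA !rdotZr; congr (_ * _).
  have rdotir u v : rdot u ('i%C *: v) = - rdot ('i%C *: u) v.
    by rewrite rdotil opprK.
  by rewrite !rdotir -linearZ fP.
have [|S SP] := bop_of_bounded flin (M := M).
  move=> y; have := rdotxx (f y); rewrite -fP => e.
  have [->|fy] := eqVneq (nrm (f y)) 0; first by rewrite mulr_ge0 ?nrm_ge0.
  have fy0 : 0 < nrm (f y) by rewrite lt_def fy nrm_ge0.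
  rewrite -(ler_pM2l fy0) -expr2 -e; apply: le_trans (rdot_le _ _) _.
  by rewrite mulrCA mulrA ler_wpM2r ?nrm_ge0.
by exists S; apply: inner_rdot => x y; rewrite SP fP.
Qed.

Lemma adjP T x y : inner (T x) y = inner x (adj T y).
Proof. by apply: xgetPex (adj_exists T) x y. Qed.

Lemma rdot_adj T x y : rdot (T x) y = rdot x (adj T y).
Proof. by rewrite /rdot adjP. Qed.

Lemma adj_uniq S T : (forall x y, rdot (T x) y = rdot x (S y)) -> adj T = S.
Proof.
move=> h; apply: bopP => y; apply: rdot_eq => x.
by rewrite rdotC -rdot_adj h rdotC.
Qed.

Lemma adjK T : adj (adj T) = T.
Proof. by apply: adj_uniq => x y; rewrite rdotC -rdot_adj rdotC. Qed.

Lemma adjM S T : adj (S * T) = adj T * adj S.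
Proof. by apply: adj_uniq => x y; rewrite !bopME !rdot_adj. Qed.

Lemma adjD S T : adj (S + T) = adj S + adj T.
Proof. by apply: adj_uniq => x y; rewrite !bopDE rdotDl rdotDr !rdot_adj. Qed.

Lemma adjN T : adj (- T) = - adj T.
Proof. by apply: adj_uniq => x y; rewrite !bopNE rdotNl rdotNr !rdot_adj. Qed.

Lemma adjB S T : adj (S - T) = adj S - adj T.
Proof. by rewrite adjD adjN. Qed.

Lemma adjZ r T : adj (r%:C *: T) = r%:C *: adj T.
Proof. by apply: adj_uniq => x y; rewrite !bopZE rdotZl rdotZr !rdot_adj. Qed.

Lemma adji T : adj ('i%C *: T) = - ('i%C *: adj T).
Proof.
apply: adj_uniq => x y; rewrite bopNE !bopZE rdotil rdot_adj linearZ.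
by rewrite rdotNr.
Qed.

Lemma adj1 : adj (1 : 'B(H)) = 1.
Proof. exact: adj_uniq. Qed.

Lemma adj0 : adj (0 : 'B(H)) = 0.
Proof. by apply: adj_uniq => x y; rewrite !bop0E rdot0l rdot0r. Qed.

Lemma opnorm_adj T : opnorm (adj T) = opnorm T.
Proof.
suff le S : opnorm (adj S) <= opnorm S.
  by apply/eqP; rewrite eq_le le -{1}(adjK T) le.
apply: opnorm_le (opnorm_ge0 _) _ => x.
have [->|fy] := eqVneq (nrm (adj S x)) 0.
  by rewrite mulr_ge0 ?nrm_ge0 ?opnorm_ge0.
have fy0 : 0 < nrm (adj S x) by rewrite lt_def fy nrm_ge0.
rewrite -(ler_pM2l fy0) -expr2 -rdotxx -rdot_adj.
apply: le_trans (rdot_le _ _) _.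
by rewrite mulrA ler_wpM2r ?nrm_ge0 // mulrC nrm_op.
Qed.

Lemma scale_mull (a : R[i]) S T : (a *: S) * T = a *: (S * T).
Proof. exact: bopP. Qed.

Lemma scale_mulr (a : R[i]) S T : S * (a *: T) = a *: (S * T).
Proof. by apply: bopP => x; rewrite !(bopME, bopZE) linearZ. Qed.

End Adjoint.

(** * The order on operators *)
Section Positive.
Context {R : realType} {H : hilbertType R}.
Implicit Types (S T U : 'B(H)) (x y z : H) (r c : R).

(** A positive operator is self-adjoint: [<T z, z>] has no imaginary part, and
    expanding this at [z = x + i y] is the polarization identity. *)
Lemma positiveP T :
  positive T <-> adj T = T /\ forall x, 0 <= rdot (T x) x.
Proof.
have posE : positive T <-> forall x, rdot (T x) ('i%C *: x) = 0 /\ 0 <= rdot (T x) x.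
  split=> h x; have := h x; rewrite innerE lecE /=.
    by move=> /andP[/eqP -> ->].
  by move=> [-> ->]; rewrite eqxx.
apply: (iff_trans posE); split=> [h|[Th T0] x]; last first.
  split=> //; have : rdot (T x) ('i%C *: x) = - rdot (T x) ('i%C *: x).
    by rewrite {1}rdot_adj Th linearZ rdotC rdotil.
  by move=> e; apply/eqP; rewrite -[_ == 0]orFb -(mulrn_eq0 _ 2) mulr2n {1}e addNr.
split=> [|x]; last by have [] := h x.
have polar x y : rdot (T x) ('i%C *: y) + rdot (T y) ('i%C *: x) = 0.
  have [+ _] := h (x + y); rewrite linearD scalerDr rdotDl !rdotDr.
  by have [-> _] := h x; have [-> _] := h y; rewrite addr0 add0r.
apply: adj_uniq => x y; have := polar x ('i%C *: y).
rewrite scalerA -expr2 sqr_i scaleN1r rdotNr linearZ rdoti addrC.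
by move/eqP; rewrite subr_eq0 => /eqP <-; rewrite rdotC.
Qed.

Lemma positive_adj T : positive T -> adj T = T.
Proof. by move=> /positiveP[]. Qed.

Lemma positive_rdot T x : positive T -> 0 <= rdot (T x) x.
Proof. by move=> /positiveP[]. Qed.

Lemma positive0 : positive (0 : 'B(H)).
Proof. by apply/positiveP; split=> [|x]; rewrite ?adj0 // bop0E rdot0l. Qed.

Lemma positive1 : positive (1 : 'B(H)).
Proof. by apply/positiveP; split=> [|x]; rewrite ?adj1 // bop1E rdotxx sqr_ge0. Qed.

Lemma positiveD S T : positive S -> positive T -> positive (S + T).
Proof.
move=> /positiveP[Sh S0] /positiveP[Th T0]; apply/positiveP.
by split=> [|x]; rewrite ?adjD ?Sh ?Th // bopDE rdotDl addr_ge0.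
Qed.

Lemma positiveZ r T : 0 <= r -> positive T -> positive (r%:C *: T).
Proof.
move=> r0 /positiveP[Th T0]; apply/positiveP.
by split=> [|x]; rewrite ?adjZ ?Th // bopZE rdotZl mulr_ge0.
Qed.

Lemma positive_conj S T : positive S -> positive (T * S * adj T).
Proof.
move=> /positiveP[Sh S0]; apply/positiveP.
split=> [|x]; first by rewrite !adjM adjK Sh mulrA.
by rewrite !bopME rdot_adj.
Qed.

Lemma op_le0 T : op_le 0 T <-> positive T.
Proof. by rewrite /op_le subr0. Qed.

Lemma op_le_refl T : op_le T T.
Proof. by rewrite /op_le subrr; exact: positive0. Qed.

Lemma op_le_trans T S U : op_le S T -> op_le T U -> op_le S U.
Proof. by move=> h1 h2; have := positiveD h2 h1; rewrite /op_le addrA subrK. Qed.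

Lemma op_leZ r S T : 0 <= r -> op_le S T -> op_le (r%:C *: S) (r%:C *: T).
Proof. by move=> r0 h; rewrite /op_le -scalerBr; exact: positiveZ. Qed.

Lemma op_le_rdot S T x : op_le S T -> rdot (S x) x <= rdot (T x) x.
Proof. by move=> /positive_rdot - /(_ x); rewrite opBE rdotBl subr_ge0. Qed.

Definition scalop r : 'B(H) := r%:C *: (1 : 'B(H)).

Lemma scalopE r x : scalop r x = r%:C *: x.
Proof. by []. Qed.

Lemma op_le_scal r c : r <= c -> op_le (scalop r) (scalop c).
Proof.
move=> rc; rewrite /op_le -scalerBl -rmorphB.
by apply: positiveZ positive1; rewrite subr_ge0.
Qed.

Lemma op_lePpos S T : positive S -> op_le S T -> positive T.
Proof. by move=> /op_le0 h1 h2; apply/op_le0; exact: op_le_trans h2. Qed.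

Lemma op_le_herm T c : adj T = T -> opnorm T <= c -> op_le T (scalop c).
Proof.
move=> Th Tc; apply/positiveP; split=> [|x].
  by rewrite adjB Th adjZ adj1.
rewrite opBE scalopE rdotBl rdotZl rdotxx subr_ge0.
apply: le_trans (rdot_le _ _) _; rewrite expr2 mulrA.
by rewrite ler_wpM2r ?nrm_ge0 ?opnorm_bound.
Qed.

Lemma op_le_opnorm T : positive T -> op_le T (scalop (opnorm T)).
Proof. by move=> /positive_adj h; exact: op_le_herm. Qed.

(** Evaluate the form of [T] at [x - t T x] and take [t = 1 / c] (or [t = 1] when
    [c = 0]). This replaces the Cauchy-Schwarz inequality for the semidefinite
    form [<T x, y>]. *)
Lemma positive_sqr T c x : 0 <= c -> positive T -> op_le T (scalop c) ->
  nrm (T x) ^+ 2 <= c * rdot (T x) x.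
Proof.
move=> c0 Tp Tc; have [Th T0] := (positiveP T).1 Tp.
have key (t : R) : 0 <= rdot (T x) x - 2 * t * nrm (T x) ^+ 2
     + t ^+ 2 * (c * nrm (T x) ^+ 2).
  have := T0 (x + (- t)%:C *: T x).
  have := op_le_rdot (T x) Tc; rewrite scalopE rdotZl rdotxx => h.
  rewrite linearD linearZ /= rdotDl !rdotDr !rdotZl !rdotZr.
  rewrite rdotxx [rdot (T (T x)) x]rdot_adj Th rdotxx => /le_trans; apply.
  have := ler_wpM2l (sqr_ge0 t) h; lra.
have [ce|cne] := eqVneq c 0.
  have := op_le_rdot x Tc; have := key 1; rewrite ce scalopE scale0r rdot0l.
  rewrite !mul0r; lra.
have c_gt0 : 0 < c by rewrite lt_def cne.
rewrite mulrC -ler_pdivrMr //; have := key c^-1.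
set a := nrm _ ^+ 2; have -> : c^-1 ^+ 2 * (c * a) = a / c by field.
by rewrite -mulrA (mulrC c^-1); lra.
Qed.

Lemma opnorm_le_pos T c : 0 <= c -> positive T -> op_le T (scalop c) ->
  opnorm T <= c.
Proof.
move=> c0 Tp Tc; apply: opnorm_le => // x.
rewrite -(@ler_pXn2r _ 2) ?nnegrE ?mulr_ge0 ?nrm_ge0 //.
apply: le_trans (positive_sqr x c0 Tp Tc) _; rewrite exprMn expr2 -mulrA.
rewrite ler_wpM2l //; have := op_le_rdot x Tc.
by rewrite scalopE rdotZl rdotxx.
Qed.

Lemma opnorm_mono S T : positive S -> op_le S T -> opnorm S <= opnorm T.
Proof.
move=> Sp ST; apply: (opnorm_le_pos (opnorm_ge0 _) Sp).
exact: op_le_trans ST (op_le_opnorm (op_lePpos Sp ST)).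
Qed.

(** If [U] inverts [S], then [|x| <= |U| |S x|], while [|S x|^2] is at most
    [|S| <S x, x>] by [positive_sqr]. The norms are enlarged by 1 to avoid
    dividing by 0 when [H] is trivial. *)
Lemma positive_inv_ge S : positive S -> invertible S ->
  exists2 c, 0 < c & op_le (scalop c) S.
Proof.
move=> Sp [U [US SU]].
have d0 : 0 < opnorm S + 1 by rewrite ltr_wpDl ?opnorm_ge0.
have e0 : 0 < opnorm U + 1 by rewrite ltr_wpDl ?opnorm_ge0.
set d := opnorm S + 1 in d0 *; set e := opnorm U + 1 in e0 *.
exists (e ^+ 2 * d)^-1; first by rewrite invr_gt0 mulr_gt0 ?exprn_gt0.
apply/positiveP; split=> [|x]; first by rewrite adjB adjZ adj1 positive_adj.
rewrite opBE scalopE rdotBl rdotZl rdotxx subr_ge0.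
rewrite mulrC ler_pdivrMr ?mulr_gt0 ?exprn_gt0 // [rdot _ _ * _]mulrC -mulrA.
have Sd : op_le S (scalop d).
  by apply: op_le_herm; rewrite ?positive_adj // lerDl.
apply: le_trans (ler_wpM2l (sqr_ge0 e) (positive_sqr x (ltW d0) Sp Sd)).
rewrite -exprMn ler_pXn2r ?nnegrE ?mulr_ge0 ?nrm_ge0 ?(ltW e0) //.
have {1}-> : x = U (S x) by rewrite -bopME US.
by apply: opnorm_bound; rewrite lerDl.
Qed.

End Positive.

(** * Weak and strong limits of operators *)
Section OperatorLimits.
Context {R : realType} {H : hilbertType R}.
Implicit Types (S T U : 'B(H)) (x y z : H) (r c : R) (u v : nat -> 'B(H)).

Definition sot_cvg u T := forall x, (fun N => nrm (u N x - T x)) @ \oo --> (0 : R).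

(** The imaginary part of [<u x, y>] is the real part of [<u x, i y>]. *)
Lemma wot_cvgP u T : wot_cvg u T <->
  forall x y, (fun N => rdot (u N x) y) @ \oo --> rdot (T x) y.
Proof.
split=> h x y.
  have /cvgrPdist_lt hxy := h x y; apply/cvgrPdist_lt => e e0.
  have /hxy : 0 < e%:C by rewrite ltcR.
  apply: filterS => N; rewrite /rdot -ReN -ReD -ltcR => /le_lt_trans; apply.
  exact: normc_ge_Re.
apply/cvgrPdist_lt => e; rewrite ltcE /= => /andP[/eqP e0 e_gt0].
have e2 : 0 < complex.Re e / 2 by rewrite divr_gt0.
have /cvgrPdist_lt/(_ _ e2) h1 := h x y.
have /cvgrPdist_lt/(_ _ e2) h2 := h x ('i%C *: y).
near=> N.
have le1 : `|rdot (T x) y - rdot (u N x) y| < complex.Re e / 2 by near: N.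
have le2 : `|rdot (T x) ('i%C *: y) - rdot (u N x) ('i%C *: y)| < complex.Re e / 2.
  by near: N.
have -> : inner (T x) y - inner (u N x) y = (rdot (T x) y - rdot (u N x) y)%:C +
    'i%C * (rdot (T x) ('i%C *: y) - rdot (u N x) ('i%C *: y))%:C.
  by rewrite !innerE [LHS]complexE.
apply: le_lt_trans (ler_normD _ _) _.
rewrite normrM normCi mul1r !normcR -rmorphD ltcE /= e0 eqxx /=.
lra.
Unshelve. all: by end_near.
Qed.

Lemma sot_wot u T : sot_cvg u T -> wot_cvg u T.
Proof.
move=> h; apply/wot_cvgP => x y.
apply: (@cvg_squeeze _ _ (fun N => nrm (u N x - T x) * nrm y)).
  by move=> N; rewrite -rdotBl; exact: CauchySchwarzR.
by rewrite -[X in _ --> X](mul0r (nrm y)); apply: cvgMl; exact: h.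
Qed.

Lemma wot_unique u S T : wot_cvg u S -> wot_cvg u T -> S = T.
Proof.
move=> /wot_cvgP uS /wot_cvgP uT; apply: bopP => x; apply: rdot_eq => y.
exact: (cvg_unique _ (uS x y) (uT x y)).
Qed.

Lemma nrm_cvg_bound (w : nat -> H) x c :
  (forall N, nrm (w N) <= c) -> (fun N => nrm (w N - x)) @ \oo --> (0 : R) ->
  nrm x <= c.
Proof.
move=> wc wx; rewrite -[c]addr0; apply: cvg_le (cvg_cst (nrm x)) (cvgD (cvg_cst c) wx).
move=> N /=; have := nrmD (w N) (x - w N); rewrite [w N + _]addrC subrK (nrmB x).
by move=> /le_trans; apply; rewrite lerD2r.
Qed.

(** The bound on the norms is what makes the pointwise limit continuous. *)
Lemma sot_complete u c : (forall N, opnorm (u N) <= c) ->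
  (forall x e, 0 < e -> exists N, forall i j, (N <= i)%N -> (N <= j)%N ->
     nrm (u i x - u j x) < e) ->
  exists T, sot_cvg u T.
Proof.
move=> uc cau; have [f fP] := choice (fun x => cauchyH (cau x)).
have flin : linear f.
  move=> a x y; apply/subr0_eq/nrm_eq0/eqP; rewrite eq_le nrm_ge0 andbT.
  have h : (fun N => nrm (u N (a *: x + y) - f (a *: x + y))
     + (complex.Re `|a| * nrm (u N x - f x) + nrm (u N y - f y))) @ \oo -->
     (0 + (complex.Re `|a| * 0 + 0) : R).
    apply: cvgD; first exact: fP.
    by apply: cvgD (fP y); apply: cvgMr; exact: fP.
  rewrite mulr0 !addr0 in h; apply: cvg_le (cvg_cst _) h => N.
  rewrite -(nrmN (u N _ - _)) -nrmZC.
  have -> : f (a *: x + y) - (a *: f x + f y) =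
      - (u N (a *: x + y) - f (a *: x + y)) + (a *: (u N x - f x) + (u N y - f y)).
    have abel (p q r s t : H) : p - (s + t) = - (q + r - p) + (q - s + (r - t)).
      by rewrite opprB (addrACA q) -opprD addrA subrK.
    by rewrite (linearP (u N)) scalerBr; exact: abel.
  by apply: le_trans (nrmD _ _) _; rewrite lerD2l nrmD.
have [|T TP] := bop_of_bounded flin (M := c).
  move=> x; apply: nrm_cvg_bound (fP x) => N.
  exact: opnorm_bound.
by exists T => x; rewrite TP; exact: fP.
Qed.

End OperatorLimits.

(** * Norm limits, Neumann inverses and square roots *)
Section UniformLimits.
Context {R : realType} {H : hilbertType R}.
Implicit Types (S T U B X Y Z : 'B(H)) (x y z : H) (r c q : R) (u v : nat -> 'B(H)).

Lemma ucvg_cst T : uniform_cvg (fun=> T) T.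
Proof. by rewrite /uniform_cvg subrr opnorm0; exact: cvg_cst. Qed.

Lemma ucvgD u v S T : uniform_cvg u S -> uniform_cvg v T ->
  uniform_cvg (fun N => u N + v N) (S + T).
Proof.
move=> uS vT; have h := cvg0D uS vT.
apply: squeeze0 h => N; rewrite opnorm_ge0 opprD addrACA /=; exact: opnormD.
Qed.

Lemma ucvgZ u r T : uniform_cvg u T -> uniform_cvg (fun N => r%:C *: u N) (r%:C *: T).
Proof.
move=> uT; have h := cvg0Ml `|r| uT.
apply: squeeze0 h => N; rewrite opnorm_ge0 -scalerBr; exact: opnormZ.
Qed.

Lemma ucvgB u v S T : uniform_cvg u S -> uniform_cvg v T ->
  uniform_cvg (fun N => u N - v N) (S - T).
Proof.
move=> uS vT; apply: ucvgD uS _.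
by rewrite /uniform_cvg; under eq_fun do rewrite -opprD opnormN.
Qed.

Lemma ucvgMl u S T : uniform_cvg u T -> uniform_cvg (fun N => S * u N) (S * T).
Proof.
move=> uT; have h := cvg0Ml (opnorm S) uT.
apply: squeeze0 h => N; rewrite opnorm_ge0 -mulrBr; exact: opnormM.
Qed.

Lemma ucvgMr u S T : uniform_cvg u T -> uniform_cvg (fun N => u N * S) (T * S).
Proof.
move=> uT; have h := cvg0Mr (opnorm S) uT.
apply: squeeze0 h => N; rewrite opnorm_ge0 -mulrBl; exact: opnormM.
Qed.

Lemma ucvg_sqr u c T : (forall N, opnorm (u N) <= c) -> uniform_cvg u T ->
  uniform_cvg (fun N => u N * u N) (T * T).
Proof.
move=> uc uT.
have h := cvg0D (cvg0Ml c uT) (cvg0Mr (opnorm T) uT).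
apply: squeeze0 h => N; rewrite opnorm_ge0 /=.
have -> : u N * u N - T * T = u N * (u N - T) + (u N - T) * T.
  by rewrite mulrBr mulrBl addrA subrK.
apply: le_trans (opnormD _ _) _; apply: lerD; last exact: opnormM.
by apply: le_trans (opnormM _ _) _; rewrite ler_wpM2r ?opnorm_ge0.
Qed.

Lemma ucvgS u T : uniform_cvg u T -> uniform_cvg (fun N => u N.+1) T.
Proof.
by rewrite /uniform_cvg => uT; rewrite (cvg_shiftS (fun N => opnorm (u N - T))).
Qed.

Lemma ucvg_adj u T : uniform_cvg u T -> uniform_cvg (fun N => adj (u N)) (adj T).
Proof. by rewrite /uniform_cvg => uT; under eq_fun do rewrite -adjB opnorm_adj. Qed.

Lemma ucvg_sot u T : uniform_cvg u T -> sot_cvg u T.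
Proof.
move=> uT x; have h := cvg0Mr (nrm x) uT.
by apply: squeeze0 h => N; rewrite nrm_ge0 -opBE nrm_op.
Qed.

Lemma ucvg_unique u S T : uniform_cvg u S -> uniform_cvg u T -> S = T.
Proof.
by move=> /ucvg_sot/sot_wot uS /ucvg_sot/sot_wot uT; exact: wot_unique uS uT.
Qed.

Lemma wot_positive u T : (forall N, positive (u N)) -> wot_cvg u T -> positive T.
Proof.
move=> up /wot_cvgP uT; apply/positiveP; split=> [|x].
  apply: adj_uniq => x y; have h1 := uT x y; have := uT y x.
  have -> : (fun N => rdot (u N y) x) = (fun N => rdot (u N x) y).
    by apply: funext => N; rewrite rdot_adj positive_adj // rdotC.
  by move=> h2; rewrite [RHS]rdotC; exact: (cvg_unique _ h1 h2).
by apply: cvg_ge0 (uT x x) => N; exact: positive_rdot.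
Qed.

Lemma ucvg_positive u T : (forall N, positive (u N)) -> uniform_cvg u T -> positive T.
Proof. by move=> up /ucvg_sot/sot_wot; exact: wot_positive. Qed.

(** Completeness of B(H), in the form in which it is used: the remainders are
    dominated by those of a geometric series. *)
Lemma geometric_ucvg u c q : 0 <= q < 1 ->
  (forall N, opnorm (u N.+1 - u N) <= c * q ^+ N) -> exists T, uniform_cvg u T.
Proof.
move=> /andP[q0 q1] uc; have q1' : 0 < 1 - q by rewrite subr_gt0.
pose b N := c * q ^+ N / (1 - q).
have c0 : 0 <= c by have := uc 0; rewrite expr0 mulr1; apply: le_trans; exact: opnorm_ge0.
have b0 N : 0 <= b N by rewrite divr_ge0 ?mulr_ge0 ?exprn_ge0 // ltW.
have ub N k : opnorm (u (N + k)%N - u N) <= b N.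
  have le : opnorm (u (N + k)%N - u N) <= b N - b (N + k)%N.
    elim: k => [|k IH]; first by rewrite addn0 !subrr opnorm0.
    rewrite addnS -(subrK (u (N + k)%N) (u _.+1)) -addrA.
    apply: le_trans (opnormD _ _) _; apply: le_trans (lerD (uc _) IH) _.
    suff -> : b (N + k).+1 = b (N + k)%N - c * q ^+ (N + k) by lra.
    by rewrite /b exprS; field; rewrite gt_eqF.
  by apply: le_trans le _; rewrite gerBl.
have bcvg : b @ \oo --> (0 : R).
  apply: cvg0Mr; apply: cvg0Ml.
  by apply: cvg_expr; rewrite ger0_norm.
have [T uT] : exists T, sot_cvg u T.
  apply: (@sot_complete _ _ _ (opnorm (u 0) + b 0)) => [N|x e e0].
    rewrite -(subrK (u 0) (u N)) addrC; apply: le_trans (opnormD _ _) _.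
    by rewrite lerD2l; exact: ub 0 N.
  have /cvgrPdist_lt/(_ e e0)[N _ hN] : (fun N => 2 * (b N * nrm x)) @ \oo --> (0 : R).
    by apply: cvg0Ml; exact: cvg0Mr.
  have {}hN := hN N (leqnn N).
  exists N => i j Ni Nj.
  rewrite sub0r normrN ger0_norm in hN; last by rewrite mulr_ge0 // mulr_ge0 ?b0 ?nrm_ge0.
  apply: le_lt_trans hN.
  have le k : (N <= k)%N -> nrm (u k x - u N x) <= b N * nrm x.
    by move=> Nk; rewrite -opBE; apply: opnorm_bound; rewrite -(subnKC Nk).
  have := nrmD (u i x - u N x) (u N x - u j x); rewrite addrA subrK (nrmB (u N x)).
  have := le _ Ni; have := le _ Nj; lra.
exists T; apply: squeeze0 bcvg => N; rewrite opnorm_ge0 /=.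
apply: opnorm_le => // x.
apply: (@nrm_cvg_bound _ _ (fun k => u N x - u (N + k)%N x)) => [k|].
  by rewrite nrmB -opBE; exact: opnorm_bound.
have := uT x; rewrite -(cvg_shiftn N).
under eq_fun do rewrite addnC.
move=> h; under eq_fun => k.
  rewrite opBE opprB addrC addrA subrK nrmB; over.
exact: h.
Qed.

(** The iteration [T |-> 1 + B T] has the partial sums of the Neumann series as
    orbit of 0; these also satisfy [u (N+1) = 1 + u N B], so the limit inverts
    [1 - B] on both sides. *)
Lemma neumann B q : opnorm B <= q -> q < 1 -> invertible (1 - B).
Proof.
move=> Bq q1; have q0 : 0 <= q by apply: le_trans Bq; exact: opnorm_ge0.
pose u N : 'B(H) := iter N (fun T => 1 + B * T) 0.
have uS N : u N.+1 = 1 + B * u N by [].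
have uSr N : u N.+1 = 1 + u N * B.
  elim: N => [|N IH]; first by rewrite uS mulr0 mul0r.
  by rewrite uS {1}IH uS mulrDr mulrDl mulr1 mul1r mulrA.
have [|N|T uT] := @geometric_ucvg u 1 q; first by rewrite q0.
  elim: N => [|N IH].
    by rewrite expr0 mulr1 uS mulr0 addr0 subr0 opnorm1.
  rewrite uS (uS N) opprD addrACA subrr add0r -mulrBr exprS mulrCA.
  apply: le_trans (opnormM _ _) _; apply: ler_pM => //; exact: opnorm_ge0.
have e1 : T = 1 + B * T.
  apply: ucvg_unique (ucvgS uT) _.
  exact: ucvgD (ucvg_cst 1) (ucvgMl B uT).
have e2 : T = 1 + T * B.
  apply: ucvg_unique (ucvgS uT) _; under eq_fun do rewrite uSr.
  exact: ucvgD (ucvg_cst 1) (ucvgMr B uT).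
exists T; split.
  by rewrite mulrBr mulr1 {1}e2 addrK.
by rewrite mulrBl mul1r {1}e1 addrK.
Qed.

(** [(1 - Y)^2 = 1 - B] means [Y = (B + Y^2) / 2]. On the ball of radius [q] the
    right-hand side is a contraction of ratio [q] that preserves the ball, as
    [(q + q^2) / 2 <= q]. *)
Lemma sqrt_one_sub B q : adj B = B -> opnorm B <= q -> q < 1 ->
  exists2 Z, adj Z = Z & Z * Z = 1 - B.
Proof.
move=> Bh Bq q1; have q0 : 0 <= q by apply: le_trans Bq; exact: opnorm_ge0.
pose u N : 'B(H) := iter N (fun Y => (2^-1)%:C *: (B + Y * Y)) 0.
have uS N : u N.+1 = (2^-1)%:C *: (B + u N * u N) by [].
have half (T : 'B(H)) : opnorm ((2^-1)%:C *: T) <= 2^-1 * opnorm T.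
  by apply: le_trans (opnormZ _ _) _; rewrite ger0_norm.
have uq N : opnorm (u N) <= q.
  elim: N => [|N IH]; first by rewrite opnorm0.
  rewrite uS; apply: le_trans (half _) _.
  have := le_trans (opnormD B (u N * u N)) (lerD Bq (opnormM (u N) (u N))).
  have := ler_pM (opnorm_ge0 _) (opnorm_ge0 _) IH IH; nra.
have uh N : adj (u N) = u N.
  elim: N => [|N IH]; first by rewrite adj0.
  by rewrite uS adjZ adjD adjM Bh IH.
have [|N|Y uY] := @geometric_ucvg u q q; first by rewrite q0.
  elim: N => [|N IH].
    by rewrite expr0 mulr1 subr0; exact: uq.
  rewrite uS (uS N) -scalerBr opprD addrACA subrr add0r.
  set v := u N.+1 in IH *.
  have -> : v * v - u N * u N = v * (v - u N) + (v - u N) * u N.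
    by rewrite mulrBr mulrBl addrA subrK.
  apply: le_trans (half _) _.
  have := le_trans (opnormD (v * (v - u N)) ((v - u N) * u N)) (lerD (opnormM _ _) (opnormM _ _)).
  have := ler_pM (opnorm_ge0 _) (opnorm_ge0 _) (uq N.+1) IH.
  have := ler_pM (opnorm_ge0 _) (opnorm_ge0 _) (uq N) IH.
  by rewrite -/v exprS; lra.
have e1 : Y = (2^-1)%:C *: (B + Y * Y).
  apply: ucvg_unique (ucvgS uY) _.
  apply: ucvgZ; apply: ucvgD (ucvg_cst B) _.
  exact: ucvg_sqr uY.
have Yh : adj Y = Y.
  apply: ucvg_unique (ucvg_adj uY) _.
  by under eq_fun do rewrite uh.
exists (1 - Y); first by rewrite adjB adj1 Yh.
have e2 : Y + Y = B + Y * Y.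
  rewrite {1 2}e1 -scalerDl -rmorphD /=.
  have -> : 2^-1 + 2^-1 = 1 :> R by lra.
  by rewrite scale1r.
rewrite mulrBl mul1r mulrBr mulr1.
have -> : B = Y + Y - Y * Y by rewrite e2 addrK.
by rewrite -addrA -opprD addrA.
Qed.

End UniformLimits.

(** * Operators bounded below, monotone sequences *)
Section PositiveFactor.
Context {R : realType} {H : hilbertType R}.
Implicit Types (S T U B X Y Z : 'B(H)) (x y z : H) (r c q : R) (u : nat -> 'B(H)).

Lemma scalopB r c : scalop (r - c) = scalop r - scalop c :> 'B(H).
Proof. by rewrite /scalop rmorphB scalerBl. Qed.

Lemma scalopZ r c : r%:C *: scalop c = scalop (r * c) :> 'B(H).
Proof. by rewrite /scalop scalerA -rmorphM. Qed.

Lemma scalop1 : scalop 1 = 1 :> 'B(H).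
Proof. by rewrite /scalop scale1r. Qed.

Lemma scalop_ge0 c : 0 <= c -> positive (scalop c : 'B(H)).
Proof. by move=> c0; exact: positiveZ positive1. Qed.

(** [X >= c > 0] is a multiple of a perturbation of 1 by a contraction: take
    [d = |X| + c], so that [c / d <= X / d <= 1]. *)
Lemma ge_scal_perturb X c : 0 < c -> op_le (scalop c) X ->
  exists d q B, [/\ 0 < d, q < 1, adj B = B, opnorm B <= q & X = d%:C *: (1 - B)].
Proof.
move=> c0 cX; have Xp : positive X by apply: op_lePpos cX; exact/scalop_ge0/ltW.
set d := opnorm X + c; have d0 : 0 < d by rewrite ltr_wpDl ?opnorm_ge0.
have dV0 : 0 <= d^-1 by rewrite invr_ge0 ltW.
have dVd : d^-1 * d = 1 by rewrite mulVf ?gt_eqF.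
have q0 : 0 <= 1 - d^-1 * c.
  by rewrite subr_ge0 mulrC ler_pdivrMr // mul1r lerDr opnorm_ge0.
have Xd : op_le X (scalop d).
  by apply: op_le_trans (op_le_opnorm Xp) _; apply: op_le_scal; rewrite lerDl ltW.
set B := 1 - d^-1%:C *: X.
have BE : B = d^-1%:C *: (scalop d - X) by rewrite scalerBr scalopZ dVd scalop1.
have Bp : positive B by rewrite BE; exact: positiveZ.
exists d, (1 - d^-1 * c), B; split=> //.
- by rewrite gtrBl mulr_gt0 // invr_gt0.
- exact: positive_adj.
- apply: opnorm_le_pos => //.
  rewrite /op_le scalopB scalop1 -scalopZ opprB addrC addrA subrK.
  by rewrite -scalerBr; exact: positiveZ.
- by rewrite /B opprB addrC subrK scalerA -rmorphM mulfV ?gt_eqF // scale1r.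
Qed.

Lemma ge_scal_invertible X c : 0 < c -> op_le (scalop c) X -> invertible X.
Proof.
move=> c0 /(ge_scal_perturb c0)[d [q [B [d0 q1 _ Bq ->]]]].
have [T [TB BT]] := neumann Bq q1.
exists (d^-1%:C *: T); split.
  by rewrite scale_mull scale_mulr TB scalerA -rmorphM mulVf ?gt_eqF // scale1r.
by rewrite scale_mull scale_mulr BT scalerA -rmorphM mulfV ?gt_eqF // scale1r.
Qed.

(** [Z] commutes with [X = Z * Z], and the two one-sided inverses of [Z] that the
    inverse of [X] provides agree. *)
Lemma ge_scal_sqrt X c : 0 < c -> op_le (scalop c) X ->
  exists Z, [/\ adj Z = Z, invertible Z & Z * Z = X].
Proof.
move=> c0 cX; have [U [UX XU]] := ge_scal_invertible c0 cX.
have [d [q [B [d0 q1 Bh Bq XE]]]] := ge_scal_perturb c0 cX.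
have [Z Zh ZZ] := sqrt_one_sub Bh Bq q1.
pose Y := (Num.sqrt d)%:C *: Z.
have YY : Y * Y = X.
  rewrite /Y scale_mull scale_mulr scalerA -rmorphM -expr2 sqr_sqrtr ?ltW //.
  by rewrite ZZ XE.
exists Y; split=> //; first by rewrite /Y adjZ Zh.
exists (U * Y); split; first by rewrite -mulrA YY.
have rinv : Y * (Y * U) = 1 by rewrite mulrA YY.
suff -> : U * Y = Y * U by [].
by rewrite -[LHS]mulr1 -[in LHS]rinv mulrA -(mulrA U) YY UX mul1r.
Qed.

Lemma op_lt_ge X : op_lt 0 X -> exists2 c, 0 < c & op_le (scalop c) X.
Proof. by rewrite /op_lt subr0 => -[Xp Xi]; exact: positive_inv_ge. Qed.

(** Bounded increasing sequences converge strongly: by [positive_sqr], the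
    increments of [u N x] are controlled by those of the bounded monotone real
    sequence [<u N x, x>]. *)
Lemma sot_monotone u c : positive (u 0) -> (forall N, op_le (u N) (u N.+1)) ->
  (forall N, op_le (u N) (scalop c)) -> exists T, sot_cvg u T.
Proof.
move=> u0 uS uc.
have umono i j : (i <= j)%N -> op_le (u i) (u j).
  move=> /subnKC <-; elim: (j - i)%N => [|k IH]; first by rewrite addn0; exact: op_le_refl.
  by rewrite addnS; exact: op_le_trans IH (uS _).
have up N : positive (u N) by apply: op_lePpos u0 _; exact: umono.
have uc' N : op_le (u N) (scalop `|c|).
  by apply: op_le_trans (uc N) _; apply: op_le_scal; exact: ler_norm.
apply: (@sot_complete _ _ _ `|c|) => [N|x e e0]; first exact: opnorm_le_pos (up N) (uc' N).
pose f N := rdot (u N x) x.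
have f_cvg : cvgn f.
  apply: nondecreasing_is_cvgn => [i j ij|]; first exact/op_le_rdot/umono.
  exists (c * nrm x ^+ 2) => _ [N _ <-].
  by have := op_le_rdot x (uc N); rewrite scalopE rdotZl rdotxx.
have key i j : (i <= j)%N -> nrm (u j x - u i x) ^+ 2 <= `|c| * (f j - f i).
  move=> ij; have Dp : positive (u j - u i) by exact: umono.
  rewrite -opBE /f -rdotBl -opBE; apply: positive_sqr => //.
  apply: op_le_trans (uc' j); rewrite /op_le opprB addrCA subrr addr0; exact: up.
have d0 : 0 < e ^+ 2 / (2 * (`|c| + 1)) by rewrite divr_gt0 ?exprn_gt0 ?mulr_gt0 ?ltr_wpDl.
have /cvgrPdist_lt/(_ _ d0)[N _ hN] := f_cvg.
exists N; suff le i j : (N <= i)%N -> (N <= j)%N -> (i <= j)%N -> nrm (u j x - u i x) < e.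
  move=> i j Ni Nj; have [ij|/ltnW ji] := leqP i j; last exact: le.
  by rewrite nrmB; exact: le.
move=> Ni Nj ij; rewrite -(@ltr_pXn2r _ 2) ?nnegrE ?nrm_ge0 ?ltW //.
apply: le_lt_trans (key _ _ ij) _.
have fij : f i <= f j by exact/op_le_rdot/umono.
have : f j - f i < e ^+ 2 / (`|c| + 1).
  have := hN _ Ni; have := hN _ Nj; rewrite /= !ltr_norml => /andP[h1 h2] /andP[h3 h4].
  have -> : e ^+ 2 / (`|c| + 1) = 2 * (e ^+ 2 / (2 * (`|c| + 1))).
    by field; rewrite gt_eqF // ltr_wpDl.
  move: h1 h2 h3 h4; move: (e ^+ 2 / _) (limn f) => a l; lra.
rewrite ltr_pdivlMr ?ltr_wpDl // => h.
by apply: le_lt_trans h; rewrite mulrC ler_wpM2l ?subr_ge0 // lerDl.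
Qed.

End PositiveFactor.

(** * Submultiplicative sequences *)
Section Submultiplicative.
Context {R : realType}.
Variable a : nat -> R.
Hypothesis a_ge0 : forall k, 0 <= a k.
Hypothesis a_submul : forall j k, a (j + k)%N <= a j * a k.

(** [C] dominates [a s / r^s] for the residues [s < p]; larger indices follow by
    splitting off [p]. *)
Lemma submul_geometric (r : R) p : 0 < r -> (0 < p)%N -> a p <= r ^+ p ->
  exists2 C, 0 < C & forall k, a k <= C * r ^+ k.
Proof.
move=> r0 p0 ap; pose C := 1 + \sum_(s < p) a s / r ^+ s.
have sum_ge0 : 0 <= \sum_(s < p) a s / r ^+ s.
  by apply: sumr_ge0 => s _; rewrite divr_ge0 // exprn_ge0 // ltW.
have C0 : 0 < C by rewrite ltr_wpDr.
exists C => //; elim/ltn_ind => k IH; have [kp|pk] := ltnP k p.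
  rewrite -ler_pdivrMr ?exprn_gt0 // /C (bigD1 (Ordinal kp)) //= addrCA lerDl.
  by rewrite addr_ge0 // sumr_ge0 // => s _; rewrite divr_ge0 // exprn_ge0 // ltW.
rewrite -(subnKC pk); apply: le_trans (a_submul _ _) _.
have kpk : (k - p < k)%N by rewrite ltn_subrL p0 (leq_trans p0 pk).
by rewrite exprD mulrCA; apply: ler_pM => //; exact: IH.
Qed.

Let b k := a k `^ (2 * k)%N%:R^-1.

Let bpow k : (0 < k)%N -> b k ^+ (2 * k) = a k.
Proof.
move=> k0; rewrite /b -powR_mulrn ?powR_ge0 // -powRrM mulVf ?powRr1 //.
by rewrite pnatr_eq0 muln_eq0 /= -lt0n.
Qed.

Let root1_cvg (C : R) : 0 < C -> (fun k => C `^ (2 * k)%N%:R^-1) @ \oo --> (1 : R).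
Proof.
move=> C0; have h : (fun k => (2 * k)%N%:R^-1 * ln C) @ \oo --> (0 : R).
  apply: cvg0Mr; rewrite -(cvg_shiftS (fun k => (2 * k)%N%:R^-1 : R)).
  apply: squeeze0 (@cvg_harmonic R) => k; rewrite invr_ge0 ler0n /=.
  by rewrite lef_pV2 ?posrE ?ltr0n ?muln_gt0 // ler_nat leq_pmull.
have := cvg_comp _ _ h (@continuous_expR R 0).
by rewrite expR0 /powR gt_eqF.
Qed.

Let I := inf (b @` [set k | (0 < k)%N]).

Let has_infI : has_inf (b @` [set k | (0 < k)%N]).
Proof.
split; first by exists (b 1); exists 1.
by exists 0 => _ [k _ <-]; exact: powR_ge0.
Qed.

Let I_le k : (0 < k)%N -> I <= b k.
Proof. by move=> k0; apply: ge_inf; [case: has_infI|exists k]. Qed.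

(** If the [p]-th root is within [e / 2] of the infimum, [submul_geometric]
    bounds the [k]-th root by [C `^ (1 / 2k)] times it, and [C `^ (1 / 2k) -> 1]. *)
Lemma fekete_root : b @ \oo --> I.
Proof.
have I0 : 0 <= I.
  apply: lb_le_inf; first by case: has_infI.
  by move=> _ [k _ <-]; exact: powR_ge0.
apply/cvgrPdist_lt => e e0.
have e2 : 0 < e / 2 by rewrite divr_gt0.
have [_ [p /= p0 <-] bp] := inf_adherent e2 has_infI; rewrite -/I in bp.
set s := I + e / 2 in bp; have s0 : 0 < s by rewrite ltr_wpDl.
have [C C0 aC] : exists2 C, 0 < C & forall k, a k <= C * (s ^+ 2) ^+ k.
  apply: (@submul_geometric _ p) => //; first exact: exprn_gt0.
  by rewrite -exprM -(bpow p0) lerXn2r ?nnegrE ?powR_ge0 ?ltW.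
have rs : 1 < (I + e) / s by rewrite ltr_pdivlMr // mul1r /s; lra.
have [N _ hN] : \forall k \near \oo, C `^ (2 * k)%N%:R^-1 < (I + e) / s.
  have e1 : 0 < (I + e) / s - 1 by rewrite subr_gt0.
  have /cvgrPdist_lt/(_ _ e1) := root1_cvg C0.
  by apply: filterS => k; rewrite distrC ltr_norml => /andP[_]; rewrite ltrBlDr subrK.
exists N.+1 => // k /= Nk; have k0 : (0 < k)%N by exact: leq_trans Nk.
rewrite distrC ger0_norm ?subr_ge0 ?I_le // ltrBlDl.
apply: (@le_lt_trans _ _ (C `^ (2 * k)%N%:R^-1 * s)).
  have sE : s = (s ^+ 2 ^+ k) `^ (2 * k)%N%:R^-1.
    rewrite -exprM -powR_mulrn ?ltW // -powRrM mulfV ?powRr1 ?ltW //.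
    by rewrite pnatr_eq0 muln_eq0 /= -lt0n.
  have sk0 : 0 <= s ^+ 2 ^+ k by rewrite !exprn_ge0 // ltW.
  rewrite [X in _ <= _ * X]sE -powRM ?(ltW C0) //.
  by apply: ge0_ler_powR; rewrite ?nnegrE ?invr_ge0 ?ler0n ?mulr_ge0 // ltW.
rewrite -ltr_pdivlMr //; apply: hN; exact: ltnW.
Qed.

Lemma root_lim_lt1 : limn b < 1 <-> exists2 p, (0 < p)%N & a p < 1.
Proof.
rewrite (cvg_lim _ fekete_root) //; split=> [I1|[p p0 ap]].
  have I1' : 0 < 1 - I by rewrite subr_gt0.
  have [_ [p /= p0 <-]] := inf_adherent I1' has_infI; rewrite -/I addrC subrK => bp.
  exists p => //; rewrite -(bpow p0) exprn_ilt1 ?powR_ge0 //.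
  by rewrite muln_eq0 /= -lt0n.
apply: le_lt_trans (I_le p0) _; rewrite -(@ltr_pXn2r _ (2 * p)) ?nnegrE ?powR_ge0 //.
  by rewrite bpow // expr1n.
by rewrite muln_gt0.
Qed.

Lemma submul_decay p : (0 < p)%N -> a p < 1 ->
  exists C q, [/\ 0 < C, 0 < q < 1 & forall k, a k <= C * q ^+ k].
Proof.
move=> p0 ap; pose t := (1 + a p) / 2.
have t0 : 0 < t by rewrite /t; have := a_ge0 p; lra.
have t1 : t < 1 by rewrite /t; lra.
have tp : (t `^ p%:R^-1) ^+ p = t.
  by rewrite -powR_mulrn ?powR_ge0 // -powRrM mulVf ?powRr1 ?ltW // pnatr_eq0 -lt0n.
have r0 : 0 < t `^ p%:R^-1 by exact: powR_gt0.
have [|C C0 aC] := @submul_geometric (t `^ p%:R^-1) p r0 p0.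
  by rewrite tp /t; lra.
exists C, (t `^ p%:R^-1); split=> //; rewrite r0 /=.
by rewrite -(@ltr_pXn2r _ p) ?nnegrE ?powR_ge0 // tp expr1n.
Qed.

End Submultiplicative.

(** * Positive linear maps on B(H) *)
Section PositiveMaps.
Context {R : realType} {H : hilbertType R}.
Implicit Types (S T U D E X Y Z : 'B(H)) (x y z : H) (r c q : R) (k N : nat).

Definition positive_map (phi : 'B(H) -> 'B(H)) :=
  [/\ forall S T, phi (S + T) = phi S + phi T,
      forall (a : R[i]) S, phi (a *: S) = a *: phi S &
      forall S, positive S -> positive (phi S)].

(** [T] as a combination of two self-adjoint operators of norm at most that of
    [T]. *)
Lemma cartesian_decomposition T :
  T = (2^-1)%:C *: (T + adj T) + (- 'i%C) *: ((2^-1)%:C *: ('i%C *: (T - adj T))).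
Proof.
have half : (2^-1)%:C + (2^-1)%:C = 1 :> R[i].
  by rewrite -rmorphD /=; have -> : 2^-1 + 2^-1 = 1 :> R by lra.
have -> : - 'i%C *: ((2^-1)%:C *: ('i%C *: (T - adj T))) = (2^-1)%:C *: (T - adj T).
  by rewrite !scalerA mulrCA mulNr -expr2 sqr_i opprK mulr1.
by rewrite -scalerDr addrACA subrr addr0 scalerDr -scalerDl half scale1r.
Qed.

Lemma herm_shift T : adj T = T -> positive (T + scalop (opnorm T)).
Proof.
move=> Th; have : op_le (- T) (scalop (opnorm T)).
  by apply: op_le_herm; rewrite ?adjN ?Th ?opnormN.
by rewrite /op_le opprK addrC.
Qed.

Lemma positive_map_iter phi k : positive_map phi -> positive_map (iter k phi).
Proof.
move=> [pD pZ pp]; elim: k => [|k [iD iZ ip]]; first by split.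
by split=> [S T|a S|S Sp] /=; rewrite ?iD ?iZ //; apply: pp; exact: ip.
Qed.

Section OneMap.
Variable phi : 'B(H) -> 'B(H).
Hypothesis phi_pos : positive_map phi.

Lemma pmapD S T : phi (S + T) = phi S + phi T.
Proof. by case: phi_pos. Qed.

Lemma pmapZ (a : R[i]) S : phi (a *: S) = a *: phi S.
Proof. by case: phi_pos. Qed.

Lemma pmap_positive S : positive S -> positive (phi S).
Proof. by case: phi_pos => _ _; exact. Qed.

Lemma pmapN S : phi (- S) = - phi S.
Proof. by rewrite -[in LHS]scaleN1r pmapZ scaleN1r. Qed.

Lemma pmapB S T : phi (S - T) = phi S - phi T.
Proof. by rewrite pmapD pmapN. Qed.

Lemma pmap0 : phi 0 = 0.
Proof. by rewrite -[X in phi X](subrr (0 : 'B(H))) pmapB subrr. Qed.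

Lemma pmap_le S T : op_le S T -> op_le (phi S) (phi T).
Proof. by move=> h; rewrite /op_le -pmapB; exact: pmap_positive. Qed.

Lemma pmap_scalop c : phi (scalop c) = c%:C *: phi 1.
Proof. exact: pmapZ. Qed.

Lemma pmap_opnorm_pos T : positive T -> opnorm (phi T) <= opnorm T * opnorm (phi 1).
Proof.
move=> Tp; apply: (@le_trans _ _ (opnorm ((opnorm T)%:C *: phi 1))).
  apply: opnorm_mono; first exact: pmap_positive.
  by rewrite -pmap_scalop; apply: pmap_le; exact: op_le_opnorm.
by apply: le_trans (opnormZ _ _) _; rewrite ger0_norm // opnorm_ge0.
Qed.

Lemma pmap_herm T : adj T = T -> adj (phi T) = phi T.
Proof.
move=> Th; rewrite -(addrK (scalop (opnorm T)) T) pmapB adjB.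
rewrite !positive_adj //; apply: pmap_positive; last exact: herm_shift.
exact/scalop_ge0/opnorm_ge0.
Qed.

Lemma pmap_opnorm_herm T : adj T = T -> opnorm (phi T) <= 3 * opnorm T * opnorm (phi 1).
Proof.
move=> Th; rewrite -{1}(addrK (scalop (opnorm T)) T) pmapB.
apply: le_trans (opnormD _ _) _; rewrite opnormN pmap_scalop.
have T0 := opnorm_ge0 T; have p0 := opnorm_ge0 (phi 1).
have h1 := opnormZ (opnorm T) (phi 1); rewrite ger0_norm // in h1.
have h2 := pmap_opnorm_pos (herm_shift Th).
have h3 : opnorm (T + scalop (opnorm T)) <= 2 * opnorm T.
  apply: le_trans (opnormD _ _) _; apply: (@le_trans _ _ (opnorm T + opnorm T * 1)).
    rewrite lerD2l; apply: le_trans (opnormZ _ _) _; rewrite ger0_norm //.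
    by rewrite ler_wpM2l ?opnorm1.
  by rewrite mulr1; lra.
have h4 := ler_wpM2r p0 h3; lra.
Qed.

(** Each of the two self-adjoint parts of [T] is a difference of positive
    operators, which costs a factor 3. *)
Lemma pmap_opnorm T : opnorm (phi T) <= 6 * opnorm T * opnorm (phi 1).
Proof.
set A := (2^-1)%:C *: (T + adj T); set B := (2^-1)%:C *: ('i%C *: (T - adj T)).
have Ah : adj A = A by rewrite adjZ adjD adjK addrC.
have Bh : adj B = B by rewrite adjZ adji adjB adjK -scalerN opprB.
rewrite {1}(cartesian_decomposition T) -/A -/B.
rewrite pmapD [phi (_ *: B)]pmapZ; apply: le_trans (opnormD _ _) _.
have half (Y : 'B(H)) c : opnorm Y <= 2 * c -> opnorm ((2^-1)%:C *: Y) <= c.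
  by have := opnormZ 2^-1 Y; rewrite ger0_norm ?invr_ge0 //; lra.
have p0 := opnorm_ge0 (phi 1).
have h2 := opnormi (phi B); rewrite scaleNr opnormN.
have hA := pmap_opnorm_herm Ah; have hB := pmap_opnorm_herm Bh.
have A1 : opnorm A <= opnorm T.
  by apply: half; apply: le_trans (opnormD _ _) _; rewrite opnorm_adj; lra.
have B1 : opnorm B <= opnorm T.
  apply: half; apply: le_trans (opnormi _) _; apply: le_trans (opnormD _ _) _.
  by rewrite opnormN opnorm_adj; lra.
by have := ler_wpM2r p0 A1; have := ler_wpM2r p0 B1; lra.
Qed.

Lemma pmap_ucvg (u : nat -> 'B(H)) T :
  uniform_cvg u T -> uniform_cvg (fun N => phi (u N)) (phi T).
Proof.
move=> uT; have h := cvg0Mr (opnorm (phi 1)) (cvg0Ml 6 uT).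
by apply: squeeze0 h => N; rewrite opnorm_ge0 -pmapB; exact: pmap_opnorm.
Qed.

End OneMap.

Section Powers.
Variable phi : 'B(H) -> 'B(H).
Hypothesis phi_pos : positive_map phi.
Let iter_pos k : positive_map (iter k phi) := positive_map_iter k phi_pos.

Lemma pmap_submul j k :
  opnorm (iter (j + k) phi 1) <= opnorm (iter j phi 1) * opnorm (iter k phi 1).
Proof.
rewrite iterD mulrC; apply: pmap_opnorm_pos => //.
exact: pmap_positive positive1.
Qed.

(** Positivity reduces power boundedness to the orbit of 1. *)
Lemma power_boundedP :
  power_bounded phi <-> exists M, forall k, opnorm (iter k phi 1) <= M.
Proof.
split=> [[M M0 hM]|[M hM]].
  exists (Num.max M 1) => -[|k]; first by rewrite le_max opnorm1 orbT.
  rewrite le_max -lee_fin; apply/orP; left.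
  apply: le_trans (hM k.+1 isT); apply: ereal_sup_ubound.
  by exists 1 => //=; exact: opnorm1.
have M0 : 0 <= M by apply: le_trans (hM 0%N); exact: opnorm_ge0.
exists (6 * M + 1) => [|k _]; first by rewrite ltr_wpDl ?mulr_ge0.
apply: ge_ereal_sup => _ [Y /= Y1 <-]; rewrite lee_fin.
apply: le_trans (pmap_opnorm (iter_pos k) Y) _.
have Y0 := opnorm_ge0 Y; have p0 := opnorm_ge0 (iter k phi 1).
have h1 := ler_pM Y0 p0 Y1 (hM k); rewrite mul1r in h1.
by rewrite -mulrA; lra.
Qed.

Lemma defectS s X : defect phi s.+1 X = defect phi s X - phi (defect phi s X).
Proof. by []. Qed.

Lemma defect_herm s X : adj X = X -> adj (defect phi s X) = defect phi s X.
Proof.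
move=> Xh; elim: s => // s IH.
by rewrite defectS adjB IH pmap_herm.
Qed.

Lemma telescope_iter D N :
  \sum_(k < N) iter k phi (D - phi D) = D - iter N phi D.
Proof.
elim: N => [|N IH]; first by rewrite big_ord0 subrr.
rewrite big_ord_recr /= IH (pmapB (iter_pos N)) -iterSr.
by rewrite addrA subrK.
Qed.

(** Put [E := D - phi D]. The hypothesis says [phi E <= E], so [phi^k E <= E] for
    all [k]. If [<E x, x> < 0], the sums of [<phi^k E x, x>] would tend to
    [-oo], but they telescope to [<(D - phi^N D) x, x>], which is bounded. *)
Lemma telescope_positive M D : (forall k, opnorm (iter k phi 1) <= M) ->
  adj D = D -> positive (D - phi D - phi (D - phi D)) -> positive (D - phi D).
Proof.
move=> hM Dh; set E := D - phi D => Ep.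
have Eh : adj E = E by rewrite adjB Dh pmap_herm.
apply/positiveP; split=> // x.
have [//|Ex] := leP 0 (rdot (E x) x); exfalso.
have leE k : op_le (iter k phi E) E.
  elim: k => [|k IH]; first exact: op_le_refl.
  rewrite iterSr; apply: op_le_trans IH.
  by apply: pmap_le.
have M0 : 0 <= M by apply: le_trans (hM 0%N); exact: opnorm_ge0.
pose K := opnorm D * (1 + 6 * M) * nrm x ^+ 2.
have K0 : 0 <= K.
  by rewrite mulr_ge0 ?sqr_ge0 // mulr_ge0 ?opnorm_ge0 // addr_ge0 // mulr_ge0.
have key N : N%:R * - rdot (E x) x <= K.
  have sum_le : rdot ((\sum_(k < N) iter k phi E) x) x <= N%:R * rdot (E x) x.
    elim: N => [|N IH]; first by rewrite big_ord0 bop0E rdot0l mul0r.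
    rewrite big_ord_recr bopDE rdotDl -natr1 mulrDl mul1r.
    by apply: lerD IH _; exact: op_le_rdot.
  rewrite mulrN lerNl; apply: le_trans sum_le; rewrite telescope_iter.
  have : opnorm (D - iter N phi D) <= opnorm D * (1 + 6 * M).
    apply: le_trans (opnormD _ _) _; rewrite opnormN mulrDr mulr1 lerD2l.
    apply: le_trans (pmap_opnorm (iter_pos N) D) _.
    by rewrite mulrCA mulrA ler_wpM2l // mulr_ge0 ?opnorm_ge0.
  move=> /opnorm_bound - /(_ x) h.
  have := CauchySchwarzR ((D - iter N phi D) x) x; rewrite ler_norml => /andP[h1 _].
  apply: le_trans h1; rewrite lerN2 /K expr2 mulrA.
  by rewrite ler_wpM2r ?nrm_ge0.
have e0 : 0 < - rdot (E x) x by rewrite oppr_gt0.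
have := key (Num.bound (K / - rdot (E x) x)).
rewrite leNgt => /negP; apply.
by rewrite -ltr_pdivrMr // archi_boundP // divr_ge0 // ltW.
Qed.

(** Descending induction on [s] with [telescope_positive], which
    reaches down to [s = 1]; the case [s = 0] is [X >= 0]. *)
Lemma defect_positive m X : power_bounded phi -> positive X ->
  positive (defect phi m X) -> forall s, (s <= m)%N -> positive (defect phi s X).
Proof.
move=> /power_boundedP[M hM] Xp Xm s sm.
have step t : positive (defect phi t.+1 X) -> positive (defect phi t X).
  case: t => [//|t]; apply: (telescope_positive hM).
  exact/defect_herm/positive_adj.
move: Xm; rewrite -(subnKC sm).
by elim: (m - s)%N => [|k IH]; rewrite ?addn0 // addnS => /step.
Qed.

Definition decaying := exists C q,
  [/\ 0 < C, 0 < q < 1 & forall k, opnorm (iter k phi 1) <= C * q ^+ k].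

(** With [q = 1 - c / d] and [D <= d]: [phi D <= D - c <= q D], hence
    [phi^k D <= q^k D], and [c <= D <= d] turns this into a bound on [phi^k 1].
    The term [2 c] in [d] keeps [q > 0]. *)
Lemma decaying_of_defect D c : 0 < c -> positive D ->
  op_le (scalop c) (D - phi D) -> decaying.
Proof.
move=> c0 Dp cD; set d := opnorm D + 2 * c.
have d0 : 0 < d by rewrite ltr_wpDl ?opnorm_ge0 ?mulr_gt0.
have cd0 : 0 < c / d by rewrite divr_gt0.
have cd1 : c / d < 1.
  by rewrite ltr_pdivrMr // mul1r /d; have := opnorm_ge0 D; lra.
set q := 1 - c / d.
have Dd : op_le D (scalop d).
  by apply: op_le_trans (op_le_opnorm Dp) _; apply: op_le_scal; rewrite lerDl mulr_ge0 ?ltW.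
have phiD : op_le (phi D) (q%:C *: D).
  have h : op_le ((c / d)%:C *: D) (scalop c).
    have -> : scalop c = (c / d)%:C *: scalop d :> 'B(H).
      by rewrite scalopZ divfK ?gt_eqF.
    by apply: op_leZ Dd; exact: ltW.
  have := op_le_trans h cD; rewrite /op_le /q rmorphB scalerBl scale1r.
  by rewrite addrAC.
have cleD : op_le (scalop c) D.
  apply: op_le_trans cD _; rewrite /op_le opprB addrCA subrr addr0.
  exact: pmap_positive.
have phik k : op_le (iter k phi D) ((q ^+ k)%:C *: D).
  elim: k => [|k IH]; first by rewrite expr0 scale1r; exact: op_le_refl.
  rewrite iterS; apply: op_le_trans (pmap_le phi_pos IH) _.
  rewrite (pmapZ phi_pos) exprS mulrC rmorphM -scalerA.
  by apply: op_leZ phiD; rewrite exprn_ge0 // subr_ge0 ltW.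
exists (d / c), q; split; first by rewrite divr_gt0.
  by rewrite /q subr_gt0 cd1 gtrBl.
move=> k; have qk0 : 0 <= q ^+ k by rewrite exprn_ge0 // subr_ge0 ltW.
apply: opnorm_le_pos; first by rewrite mulr_ge0 // divr_ge0 ?ltW.
  exact: pmap_positive positive1.
have h1 : op_le (c%:C *: iter k phi 1) ((q ^+ k)%:C *: scalop d).
  rewrite -pmap_scalop //; apply: op_le_trans (pmap_le (iter_pos k) cleD) _.
  by apply: op_le_trans (phik k) _; exact: op_leZ.
have cV : 0 <= c^-1 by rewrite invr_ge0 ltW.
have := op_leZ cV h1; rewrite scalerA -rmorphM mulVf ?gt_eqF // scale1r !scalopZ.
by have -> : c^-1 * (q ^+ k * d) = d / c * q ^+ k by ring.
Qed.

Lemma decaying_of_lt1 p : (0 < p)%N -> opnorm (iter p phi 1) < 1 -> decaying.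
Proof.
by apply: submul_decay => [k|j k]; [exact: opnorm_ge0|exact: pmap_submul].
Qed.

Lemma decaying_cvg0 : decaying <-> (fun k => opnorm (iter k phi 1)) @ \oo --> (0 : R).
Proof.
split=> [[C [q [C0 /andP[q0 q1] hC]]]|/cvgrPdist_lt/(_ 1 ltr01)[N _ hN]].
  apply: (@squeeze0 _ _ (fun k => C * q ^+ k)) => [k|].
    by rewrite opnorm_ge0 hC.
  by apply: cvg0Ml; apply: cvg_expr; rewrite ger0_norm // ltW.
apply: (@decaying_of_lt1 N.+1) => //.
by have := hN _ (leqnSn N); rewrite /= sub0r normrN ger0_norm ?opnorm_ge0.
Qed.

Lemma decaying_root :
  decaying <-> limn (fun k => opnorm (iter k phi 1) `^ (2 * k)%N%:R^-1) < 1.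
Proof.
apply: iff_trans (iff_sym (root_lim_lt1 _ _)) => [|k|j k]; last 2 first.
- exact: opnorm_ge0.
- exact: pmap_submul.
split=> [/decaying_cvg0/cvgrPdist_lt/(_ 1 ltr01)[N _ hN]|[p]].
  exists N.+1 => //.
  by have := hN _ (leqnSn N); rewrite /= sub0r normrN ger0_norm ?opnorm_ge0.
exact: decaying_of_lt1.
Qed.

Lemma decaying_power_bounded : decaying -> power_bounded phi.
Proof.
move=> [C [q [C0 /andP[q0 q1] hC]]]; apply/power_boundedP; exists C => k.
by apply: le_trans (hC k) _; rewrite ler_piMr ?(ltW C0) ?exprn_ile1 ?(ltW q0) ?(ltW q1).
Qed.

Lemma decaying_fixed0 Y : decaying -> phi Y = Y -> Y = 0.
Proof.
move=> /decaying_cvg0 h Yf; apply: opnorm_eq0; apply/eqP.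
rewrite eq_le opnorm_ge0 andbT.
apply: (cvg_le _ (cvg_cst (opnorm Y)) (cvg0Ml (6 * opnorm Y) h)) => k.
have {1}-> : opnorm Y = opnorm (iter k phi Y).
  by congr opnorm; elim: k => // k IH; rewrite iterS -IH Yf.
exact: pmap_opnorm.
Qed.

(** A difference of two solutions is, one factor [id - phi] at a time, a fixed
    point of [phi], hence 0. *)
Lemma defect_inj m X Y : decaying -> defect phi m X = defect phi m Y -> X = Y.
Proof.
move=> dec; elim: m => // m IH; rewrite !defectS => e.
apply: IH; apply/subr0_eq; apply: (decaying_fixed0 dec); rewrite (pmapB phi_pos).
have abel (p q r s : 'B(H)) : p - q = r - s -> q - s = p - r.
  move=> h; have -> : p = r - s + q by rewrite -h subrK.
  by rewrite addrAC (addrAC r) subrr add0r addrC.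
exact: abel.
Qed.

(** Pascal's rule adds the bounds for [(m, N + 1)] and, with a factor [t], for
    [(m + 1, N)]; the sum is [t (1 - t)^-(m + 1) + (1 - t)^-m], which is
    [(1 - t)^-(m + 1)]. *)
Lemma bin_expr_le (m N : nat) (t : R) : 0 < t < 1 ->
  'C(N + m, m)%:R * t ^+ N <= ((1 - t) ^+ m)^-1.
Proof.
move=> /andP[t0 t1]; have t1' : 0 < 1 - t by rewrite subr_gt0.
elim: m N => [|m IH] N.
  by rewrite bin0 mul1r expr0 invr1 exprn_ile1 // ltW.
elim: N => [|N IHN].
  rewrite add0n binn expr0 mulr1 -[X in X <= _]invr1 lef_pV2 ?posrE ?exprn_gt0 //.
  by rewrite exprn_ile1 ?gerBl ?(ltW t1') ?(ltW t0).
rewrite addSn binS natrD mulrDl.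
have h1 := IH N.+1; rewrite addSnnS in h1.
have : 'C(N + m.+1, m.+1)%:R * t ^+ N.+1 <= t * ((1 - t) ^+ m.+1)^-1.
  by rewrite exprS mulrCA; rewrite ler_wpM2l // ltW.
have e : ((1 - t) ^+ m.+1)^-1 = t * ((1 - t) ^+ m.+1)^-1 + ((1 - t) ^+ m)^-1.
  by rewrite exprS; field; rewrite expf_neq0 gt_eqF.
by move=> h2; rewrite [X in _ <= X]e; exact: lerD h2 h1.
Qed.

(** Partial sums of the expansion of [(id - phi)^-(m + 1) S]. *)
Definition wsum m S N : 'B(H) :=
  \sum_(0 <= k < N) 'C(k + m, m)%:R *: iter k phi S.

Lemma wsumS m S N :
  wsum m S N.+1 = wsum m S N + 'C(N + m, m)%:R *: iter N phi S.
Proof. by rewrite /wsum big_nat_recr. Qed.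

(** Write [q = t^2]: one factor [t^k] absorbs the growth of the binomial
    coefficient, the other makes the series geometric. *)
Lemma wsum_cvg m S : decaying -> exists X, uniform_cvg (wsum m S) X.
Proof.
move=> [C [q [C0 /andP[q0 q1] hC]]]; set t := Num.sqrt q.
have t0 : 0 < t by rewrite sqrtr_gt0.
have t1 : t < 1 by rewrite -sqrtr1 ltr_sqrt.
have qE : q = t * t by rewrite -expr2 sqr_sqrtr // ltW.
apply: (@geometric_ucvg _ _ _ (((1 - t) ^+ m)^-1 * (6 * opnorm S * C)) t).
  by rewrite ltW.
move=> N; rewrite wsumS addrC addKr -(rmorph_nat (@real_complex R)).
apply: le_trans (opnormZ _ _) _; rewrite ger0_norm ?ler0n //.
have h1 : opnorm (iter N phi S) <= 6 * opnorm S * C * t ^+ N * t ^+ N.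
  apply: le_trans (pmap_opnorm (iter_pos N) S) _.
  rewrite -!mulrA ler_wpM2l // ler_wpM2l ?opnorm_ge0 //.
  by rewrite -exprMn -qE.
apply: le_trans (ler_wpM2l (ler0n _ _) h1) _.
have h2 := bin_expr_le m N (introT andP (conj t0 t1)).
have h3 : 0 <= 6 * opnorm S * C * t ^+ N.
  by rewrite !mulr_ge0 ?opnorm_ge0 ?exprn_ge0 ?(ltW C0) ?(ltW t0).
have := ler_wpM2r h3 h2; congr (_ <= _); ring.
Qed.

Lemma wsum_defect0 S N : wsum 0 S N.+1 - phi (wsum 0 S N) = S.
Proof.
elim: N => [|N IH].
  by rewrite wsumS /wsum big_geq // (pmap0 phi_pos) bin0 scale1r add0r subr0.
rewrite wsumS [X in phi X]wsumS (pmapD phi_pos) (pmapZ phi_pos) !bin0 !scale1r.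
by rewrite iterS opprD addrACA subrr addr0.
Qed.

(** Pascal's rule. The shift between the two numbers of terms makes the identity
    exact, so no remainder has to be estimated in the limit. *)
Lemma wsum_defectS m S N : wsum m.+1 S N.+1 - phi (wsum m.+1 S N) = wsum m S N.+1.
Proof.
elim: N => [|N IH].
  by rewrite !wsumS /wsum !big_geq // (pmap0 phi_pos) !add0n !binn subr0.
rewrite wsumS [X in phi X]wsumS (pmapD phi_pos) (pmapZ phi_pos) -iterS opprD.
rewrite addrACA IH.
rewrite [RHS]wsumS -scalerBl; congr (_ + _ *: _).
by rewrite addSn binS natrD addrC addKr addSnnS.
Qed.

Lemma wsum_lim0 S X : uniform_cvg (wsum 0 S) X -> X - phi X = S.
Proof.
move=> XP; have h := ucvgB (ucvgS XP) (pmap_ucvg phi_pos XP).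
by apply: ucvg_unique h _; under eq_fun do rewrite wsum_defect0; exact: ucvg_cst.
Qed.

Lemma wsum_limS m S X Y : uniform_cvg (wsum m.+1 S) X -> uniform_cvg (wsum m S) Y ->
  X - phi X = Y.
Proof.
move=> XP YP; have h := ucvgB (ucvgS XP) (pmap_ucvg phi_pos XP).
by apply: ucvg_unique h _; under eq_fun do rewrite wsum_defectS; exact: ucvgS.
Qed.

Lemma wsum_solution m S X : decaying -> uniform_cvg (wsum m S) X ->
  defect phi m.+1 X = S.
Proof.
move=> dec; elim: m X => [|m IH] X XP; first exact: wsum_lim0.
have [Y YP] := wsum_cvg m S dec.
by rewrite /defect iterSr (wsum_limS XP YP); exact: IH.
Qed.

Lemma wsum_ge m S N : positive S -> op_le S (wsum m S N.+1).
Proof.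
move=> Sp; elim: N => [|N IH].
  by rewrite wsumS /wsum big_geq // add0r add0n binn scale1r; exact: op_le_refl.
apply: op_le_trans IH _; rewrite [X in op_le _ X]wsumS /op_le addrC addKr.
rewrite -(rmorph_nat (@real_complex R)).
by apply: positiveZ; [exact: ler0n|exact: pmap_positive].
Qed.

Lemma wsum_lim_ge m S X : positive S -> uniform_cvg (wsum m S) X -> op_le S X.
Proof.
move=> Sp XP; apply: ucvg_positive (ucvgB (ucvgS XP) (ucvg_cst S)) => N.
exact: wsum_ge.
Qed.

End Powers.
End PositiveMaps.

(** * Weak limits and the map attached to a tuple of operators *)
Section WeakLimits.
Context {R : realType} {H : hilbertType R}.
Implicit Types (S T V : 'B(H)) (u v : nat -> 'B(H)).

Lemma wot_cvgD u v S T : wot_cvg u S -> wot_cvg v T ->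
  wot_cvg (fun N => u N + v N) (S + T).
Proof.
move=> /wot_cvgP uS /wot_cvgP vT; apply/wot_cvgP => x y.
rewrite bopDE rdotDl; under eq_fun do rewrite bopDE rdotDl.
by apply: cvgD; [exact: uS|exact: vT].
Qed.

Lemma wot_cvgZr u T (r : R) : wot_cvg u T ->
  wot_cvg (fun N => r%:C *: u N) (r%:C *: T).
Proof.
move=> /wot_cvgP uT; apply/wot_cvgP => x y.
rewrite bopZE rdotZl; under eq_fun do rewrite bopZE rdotZl.
by apply: cvgMr; exact: uT.
Qed.

Lemma wot_cvgi u T : wot_cvg u T -> wot_cvg (fun N => 'i%C *: u N) ('i%C *: T).
Proof.
move=> /wot_cvgP uT; apply/wot_cvgP => x y.
rewrite bopZE rdotil; under eq_fun do rewrite bopZE rdotil.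
by apply: cvgN; exact: uT.
Qed.

Lemma wot_cvgZ u T (a : R[i]) : wot_cvg u T -> wot_cvg (fun N => a *: u N) (a *: T).
Proof.
have aE S : a *: S = (complex.Re a)%:C *: S + (complex.Im a)%:C *: ('i%C *: S).
  by rewrite scalerA [_ * 'i%C]mulrC -scalerDl -complexE.
move=> uT; rewrite aE.
have -> : (fun N => a *: u N) = fun N =>
    (complex.Re a)%:C *: u N + (complex.Im a)%:C *: ('i%C *: u N).
  by apply: funext => N; exact: aE.
exact: wot_cvgD (wot_cvgZr uT) (wot_cvgZr (wot_cvgi uT)).
Qed.

Lemma wot_cvg_conj u T V : wot_cvg u T ->
  wot_cvg (fun N => V * u N * adj V) (V * T * adj V).
Proof.
move=> /wot_cvgP uT; apply/wot_cvgP => x y.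
rewrite !bopME rdot_adj; under eq_fun do rewrite !bopME rdot_adj.
exact: uT.
Qed.

End WeakLimits.

Section Words.
Context {R : realType} {H : hilbertType R} {n : nat}.
Implicit Types (a : seq 'I_n -> R) (X : 'I_n -> 'B(H)) (S T V W Y Z : 'B(H)).

Lemma op_word_similar X V W w : W * V = 1 -> V * W = 1 ->
  op_word (fun i => V * X i * W) w = V * op_word X w * W.
Proof.
move=> WV VW; rewrite /op_word; elim: w => [|i w IH].
  by rewrite !big_nil mulr1.
by rewrite !big_cons IH !mulrA -(mulrA _ W V) WV mulr1.
Qed.

Lemma nc_eval_similar X V W (p : ncpoly R n) : W * V = 1 -> V * W = 1 ->
  nc_eval (fun i => V * X i * W) p = V * nc_eval X p * W.
Proof.
move=> WV VW; rewrite /nc_eval mulr_sumr mulr_suml; apply: eq_bigr => w _.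
by rewrite op_word_similar // scale_mulr scale_mull.
Qed.

Lemma Phi_psumS a X Y N : Phi_psum a X Y N.+1 = Phi_psum a X Y N +
  \sum_(w : N.+1.-tuple 'I_n) (a w)%:C *: (op_word X w * Y * adj (op_word X w)).
Proof. by rewrite /Phi_psum big_nat_recr. Qed.

Lemma Phi_psum0 a X Y : Phi_psum a X Y 0 = 0.
Proof. by rewrite /Phi_psum big_geq. Qed.

(** The congruence by [V] absorbs the similarity: [W V] cancels inside each
    word, and on the right the adjoints do the same. *)
Lemma Phi_psum_similar a X V W Z N : W * V = 1 -> V * W = 1 ->
  Phi_psum a (fun i => V * X i * W) (V * Z * adj V) N = V * Phi_psum a X Z N * adj V.
Proof.
move=> WV VW; have VW' : adj V * adj W = 1 by rewrite -adjM WV adj1.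
elim: N => [|N IH]; first by rewrite !Phi_psum0 mulr0 mul0r.
rewrite !Phi_psumS IH mulrDr mulrDl; congr (_ + _).
rewrite mulr_sumr mulr_suml; apply: eq_bigr => w _.
rewrite op_word_similar // scale_mulr scale_mull !adjM !mulrA; congr (_ *: _).
by rewrite -(mulrA _ W V) WV mulr1 -(mulrA _ (adj V) (adj W)) VW' mulr1.
Qed.

Section Coefficients.
Variable a : seq 'I_n -> R.
Hypothesis a_ge0 : forall w, 0 <= a w.

Lemma word_sum_positive X Y k : positive Y ->
  positive (\sum_(w : k.-tuple 'I_n) (a w)%:C *: (op_word X w * Y * adj (op_word X w))).
Proof.
move=> Yp; apply: big_ind => [|S T|w _]; first exact: positive0.
  exact: positiveD.
by apply: positiveZ => //; exact: positive_conj.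
Qed.

Lemma Phi_psum_pmap X N : positive_map (fun Y => Phi_psum a X Y N).
Proof.
elim: N => [|N [iD iZ ip]].
  by split=> [S T|c S|S _]; rewrite !Phi_psum0 ?addr0 ?scaler0 //; exact: positive0.
split=> [S T|c S|S Sp]; rewrite !Phi_psumS.
- rewrite iD addrACA; congr (_ + _); rewrite -big_split; apply: eq_bigr => w _ /=.
  by rewrite mulrDr mulrDl scalerDr.
- rewrite iZ scalerDr; congr (_ + _); rewrite scaler_sumr; apply: eq_bigr => w _.
  by rewrite scale_mulr scale_mull !scalerA mulrC.
- by apply: positiveD; [exact: ip|exact: word_sum_positive].
Qed.

Lemma Phi_psum_mono X Y N : positive Y ->
  op_le (Phi_psum a X Y N) (Phi_psum a X Y N.+1).
Proof.
move=> Yp; rewrite Phi_psumS /op_le addrC addKr; exact: word_sum_positive.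
Qed.

Section Summable.
Variable X : 'I_n -> 'B(H).
Hypothesis X_sum : Phi_summable a X.

Lemma Phi_psum1_bounded : exists c, forall N, op_le (Phi_psum a X 1 N) (scalop c).
Proof.
have [T uT] := X_sum; exists (opnorm T) => N.
have pos N' : positive (Phi_psum a X 1 N').
  by have [_ _] := Phi_psum_pmap X N'; apply; exact: positive1.
have Tp : positive T by apply: wot_positive pos uT.
apply: op_le_trans (op_le_opnorm Tp).
apply/positiveP; split=> [|x]; first by rewrite adjB !positive_adj.
rewrite opBE rdotBl subr_ge0.
have /wot_cvgP/(_ x x) h := uT.
rewrite -(cvg_lim _ h) //.
apply: (nondecreasing_cvgn_le (u_ := fun N => rdot (Phi_psum a X 1 N x) x)).
  apply/nondecreasing_seqP => k; apply: op_le_rdot; apply: Phi_psum_mono; exact: positive1.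
exact: cvgP h.
Qed.

(** [Y <= |Y|], so the partial sums at [Y] are dominated by those at 1 and
    increase to a strong limit. *)
Lemma Phi_cvg_positive Y : positive Y -> exists T, wot_cvg (Phi_psum a X Y) T.
Proof.
move=> Yp; have [c hc] := Phi_psum1_bounded.
have [||N|T] := @sot_monotone _ _ (Phi_psum a X Y) (opnorm Y * c).
- by rewrite Phi_psum0; exact: positive0.
- by move=> N; exact: Phi_psum_mono.
- apply: op_le_trans (pmap_le (Phi_psum_pmap X N) (op_le_opnorm Yp)) _.
  rewrite (pmap_scalop (Phi_psum_pmap X N)) -scalopZ.
  by apply: op_leZ (opnorm_ge0 _) (hc N).
by move=> /sot_wot; exists T.
Qed.

(** Every operator is a linear combination of positive ones. *)
Lemma Phi_cvg Y : exists T, wot_cvg (Phi_psum a X Y) T.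
Proof.
have lin (c : R[i]) S T : (exists U, wot_cvg (Phi_psum a X S) U) ->
    (exists U, wot_cvg (Phi_psum a X T) U) -> exists U, wot_cvg (Phi_psum a X (S + c *: T)) U.
  move=> [U hU] [U' hU']; exists (U + c *: U').
  have -> : Phi_psum a X (S + c *: T) = fun N => Phi_psum a X S N + c *: Phi_psum a X T N.
    by apply: funext => N; have [iD iZ _] := Phi_psum_pmap X N; rewrite iD iZ.
  exact: wot_cvgD hU (wot_cvgZ hU').
have herm S : adj S = S -> exists U, wot_cvg (Phi_psum a X S) U.
  move=> Sh; rewrite -(addrK (scalop (opnorm S)) S) -scaleN1r; apply: lin.
    by apply: Phi_cvg_positive; exact: herm_shift.
  by apply: Phi_cvg_positive; exact/scalop_ge0/opnorm_ge0.
rewrite (cartesian_decomposition Y).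
apply: (lin (- 'i%C)); apply: herm.
  by rewrite adjZ adjD adjK addrC.
by rewrite adjZ adji adjB adjK -scalerN opprB.
Qed.

Lemma PhiP Y : wot_cvg (Phi_psum a X Y) (Phi a X Y).
Proof. exact: xgetPex (Phi_cvg Y). Qed.

Lemma Phi_eq Y T : wot_cvg (Phi_psum a X Y) T -> Phi a X Y = T.
Proof. by move=> hT; exact: wot_unique (@PhiP Y) hT. Qed.

Lemma Phi_pmap : positive_map (Phi a X).
Proof.
split=> [S T|c S|S Sp].
- apply: Phi_eq; have -> : Phi_psum a X (S + T) = fun N => Phi_psum a X S N + Phi_psum a X T N.
    by apply: funext => N; have [iD _ _] := Phi_psum_pmap X N; rewrite iD.
  by apply: wot_cvgD; exact: PhiP.
- apply: Phi_eq; have -> : Phi_psum a X (c *: S) = fun N => c *: Phi_psum a X S N.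
    by apply: funext => N; have [_ iZ _] := Phi_psum_pmap X N; rewrite iZ.
  by apply: wot_cvgZ; exact: PhiP.
- apply: wot_positive (@PhiP S) => N.
  by have [_ _] := Phi_psum_pmap X N; apply.
Qed.

Section Similar.
Variables V W : 'B(H).
Hypotheses (WV : W * V = 1) (VW : V * W = 1).
Let X' i := V * X i * W.

Lemma Phi_summable_similar : Phi_summable a X'.
Proof.
rewrite /Phi_summable.
have -> : (1 : 'B(H)) = V * (W * adj W) * adj V.
  by rewrite mulrA VW mul1r -adjM VW adj1.
have [T hT] := Phi_cvg (W * adj W); exists (V * T * adj V).
have -> : Phi_psum a X' (V * (W * adj W) * adj V) =
    fun N => V * Phi_psum a X (W * adj W) N * adj V.
  by apply: funext => N; exact: Phi_psum_similar.
exact: wot_cvg_conj.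
Qed.

End Similar.
End Summable.

Section SimilarMap.
Variables (X : 'I_n -> 'B(H)) (V W : 'B(H)).
Hypotheses (X_sum : Phi_summable a X) (WV : W * V = 1) (VW : V * W = 1).
Let X' i := V * X i * W.

Lemma Phi_similar Z : Phi a X' (V * Z * adj V) = V * Phi a X Z * adj V.
Proof.
apply: Phi_eq; first exact: Phi_summable_similar.
have -> : Phi_psum a X' (V * Z * adj V) = fun N => V * Phi_psum a X Z N * adj V.
  by apply: funext => N; exact: Phi_psum_similar.
by apply: wot_cvg_conj; exact: PhiP.
Qed.

Lemma iter_Phi_similar k Z :
  iter k (Phi a X') (V * Z * adj V) = V * iter k (Phi a X) Z * adj V.
Proof. by elim: k => // k IH; rewrite !iterS IH Phi_similar. Qed.

Lemma defect_Phi_similar s Z :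
  defect (Phi a X') s (V * Z * adj V) = V * defect (Phi a X) s Z * adj V.
Proof.
by elim: s => // s IH; rewrite !defectS IH Phi_similar mulrBr mulrBl.
Qed.

Lemma power_bounded_similar : power_bounded (Phi a X) -> power_bounded (Phi a X').
Proof.
have pos := Phi_pmap X_sum; have pos' := Phi_pmap (Phi_summable_similar X_sum WV VW).
move=> /(power_boundedP pos)[M hM]; apply/(power_boundedP pos').
exists (opnorm V * (6 * opnorm (W * adj W) * M) * opnorm (adj V)) => k.
have -> : (1 : 'B(H)) = V * (W * adj W) * adj V.
  by rewrite mulrA VW mul1r -adjM VW adj1.
rewrite iter_Phi_similar; apply: le_trans (opnormM _ _) _.
rewrite ler_wpM2r ?opnorm_ge0 //; apply: le_trans (opnormM _ _) _.
rewrite ler_wpM2l ?opnorm_ge0 //.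
apply: le_trans (pmap_opnorm (positive_map_iter k pos) _) _.
by rewrite ler_wpM2l ?mulr_ge0 ?opnorm_ge0.
Qed.

End SimilarMap.
End Coefficients.
End Words.

(** * The equivalences *)
Theorem theorem3p7 (R : realType) (H : hilbertType R) (n m : nat)
    (n_gt0 : (0 < n)%N) (m_gt0 : (0 < m)%N)
    (a : seq 'I_n -> R) (a_reg : positive_regular a)
    (P : set (ncpoly R n)) (A : 'I_n -> 'B(H))
    (A_sum : Phi_summable a A)
    (A_P : forall p, P p -> nc_eval A p = 0) :
  [<->
    (* i *)
    exists T : 'I_n -> 'B(H),
      [/\ nc_variety a m P T,
          op_lt 0 (defect (Phi a T) m 1) &
          exists Y Yinv : 'B(H),
            inverse_of Yinv Y /\ forall i, A i = Yinv * T i * Y];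
    (* ii *)
    power_bounded (Phi a A) /\
      exists Q : 'B(H), positive Q /\ op_lt 0 (defect (Phi a A) m Q);
    (* iii *)
    joint_radius a A < 1;
    (* iv *)
    (fun k => opnorm (iter k (Phi a A) 1)) @ \oo --> (0 : R);
    (* v *)
    power_bounded (Phi a A) /\
      exists S : 'B(H), [/\ positive S, invertible S &
        exists X : 'B(H), positive X /\ defect (Phi a A) m X = S]
  ] /\
  (joint_radius a A < 1 ->
    forall S : 'B(H), positive S -> invertible S ->
      exists X : 'B(H),
        [/\ uniform_cvg
              (fun N => \sum_(0 <= k < N)
                 'C(k + m - 1, m - 1)%:R *: iter k (Phi a A) S) X,
            positive X,
            defect (Phi a A) m X = S,
            forall X' : 'B(H),
              positive X' -> defect (Phi a A) m X' = S -> X' = X &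
            invertible X]).
Proof.
have a0 : forall w, 0 <= a w by case: a_reg.
have pos := Phi_pmap a0 A_sum.
split; last first.
  move=> /(decaying_root pos) dec S Sp Si.
  have [X XP] := wsum_cvg pos m.-1 S dec.
  have sol : defect (Phi a A) m X = S.
    by rewrite -(prednK m_gt0); exact: wsum_solution XP.
  have SX := wsum_lim_ge pos Sp XP.
  have [c c0 cS] := positive_inv_ge Sp Si.
  exists X; split=> //.
  - have e : (fun N => \sum_(0 <= k < N) 'C(k + m - 1, m - 1)%:R *: iter k (Phi a A) S)
        = wsum (Phi a A) m.-1 S.
      apply: funext => N; apply: eq_bigr => k _.
      by rewrite -addnBA // subn1.
    by rewrite e.
  - exact: op_lePpos Sp SX.
  - by move=> X' _ X'sol; exact: (defect_inj pos dec (etrans X'sol (esym sol))).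
  - exact: ge_scal_invertible c0 (op_le_trans cS SX).
tfae.
- move=> [T [[[T_sum T_pos] _] T_lt [Y [Z [[ZY YZ] AE]]]]].
  have posT := Phi_pmap a0 T_sum.
  have AE' : A = fun i => Z * T i * Y by apply: funext.
  split.
    rewrite AE'; apply: power_bounded_similar => //.
    apply/(power_boundedP posT); exists 1 => k.
    apply: opnorm_le_pos => //.
      by apply: (pmap_positive (positive_map_iter k posT)); exact: positive1.
    rewrite scalop1; elim: k => [|k IH]; first exact: op_le_refl.
    rewrite iterS; apply: op_le_trans (pmap_le posT IH) _.
    by have := T_pos 1 m_gt0; rewrite /defect /op_le subr0.
  exists (Z * 1 * adj Z); split; first exact: positive_conj positive1.
  rewrite AE' defect_Phi_similar //.
  move: T_lt; rewrite /op_lt !subr0 => -[Dp [U [UD DU]]].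
  split; first exact: positive_conj.
  have ZY' : adj Y * adj Z = 1 by rewrite -adjM ZY adj1.
  have YZ' : adj Z * adj Y = 1 by rewrite -adjM YZ adj1.
  exists (adj Y * U * Y); split.
    by rewrite !mulrA -(mulrA _ Y Z) YZ mulr1 -(mulrA _ U) UD mulr1.
  by rewrite !mulrA -(mulrA _ (adj Z)) YZ' mulr1 -(mulrA Z) DU mulr1.
- move=> [pb [Q [Qp Qlt]]]; apply/(decaying_root pos).
  have [c c0 cD] := op_lt_ge Qlt.
  have Dp : positive (defect (Phi a A) m Q).
    by move: Qlt; rewrite /op_lt subr0 => -[].
  apply: (decaying_of_defect pos c0 (D := defect (Phi a A) m.-1 Q)).
    by apply: (defect_positive pos pb Qp Dp); exact: leq_pred.
  by rewrite -defectS prednK.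
- by move=> /(decaying_root pos) /(decaying_cvg0 pos).
- move=> /(decaying_cvg0 pos) dec; split; first exact: decaying_power_bounded.
  have [X XP] := wsum_cvg pos m.-1 1 dec.
  exists 1; split; [exact: positive1 | by exists 1; rewrite /inverse_of mulr1 | exists X].
  split; first exact: op_lePpos positive1 (wsum_lim_ge pos positive1 XP).
  by rewrite -(prednK m_gt0); exact: wsum_solution XP.
- move=> [pb [S [Sp Si [X [Xp XS]]]]].
  have Dp s : (s <= m)%N -> positive (defect (Phi a A) s X).
    by apply: (defect_positive pos pb Xp); rewrite XS.
  have [c c0 cS] := positive_inv_ge Sp Si.
  have SX : op_le S X.
    have {Xp} : forall s, (s <= m)%N -> op_le (defect (Phi a A) s X) X.
      elim=> [|s IH] sm; first exact: op_le_refl.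
      apply: op_le_trans (IH (ltnW sm)).
      rewrite defectS /op_le opprB addrCA subrr addr0.
      by apply: pmap_positive pos _ _; apply: Dp; exact: ltnW.
    by move=> /(_ m (leqnn m)); rewrite XS.
  have [Z [Zh [V [VZ ZV]] ZZ]] := ge_scal_sqrt c0 (op_le_trans cS SX).
  have ZVh : Z * adj V = 1 by rewrite -[X in X * _]Zh -adjM VZ adj1.
  have VX : V * X * adj V = 1 by rewrite -ZZ mulrA VZ mul1r.
  pose T i := V * A i * Z.
  exists T; split.
  + split; first split.
    * exact: Phi_summable_similar.
    * move=> s /andP[_ sm]; rewrite -VX defect_Phi_similar //.
      by apply/op_le0; apply: positive_conj; exact: Dp.
    * move=> p Pp; rewrite nc_eval_similar // A_P //.
      by rewrite mulr0 mul0r.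
  + rewrite -VX defect_Phi_similar // XS /op_lt subr0; split.
      exact: positive_conj.
    have [U [US SU]] := Si; exists (Z * U * Z).
    have VhZ : adj V * Z = 1 by rewrite -[X in _ * X]Zh -adjM ZV adj1.
    split.
      by rewrite !mulrA -(mulrA _ Z V) ZV mulr1 -(mulrA _ U) US mulr1.
    by rewrite !mulrA -(mulrA _ (adj V) Z) VhZ mulr1 -(mulrA V) SU mulr1.
  + exists V, Z; split=> // i.
    by rewrite /T !mulrA ZV mul1r -mulrA ZV mulr1.
Qed.
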